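(* Let $\mathcal{H}$ be a separable real Hilbert space, $G\in\mathcal{B}(\mathcal{H},\mathbb{R}^n)$, $\mathcal{C}_{\mathrm{obs}}\in\mathcal{B}(\mathbb{R}^n)$ self-adjoint and positive, $\mathcal{C}_{\mathrm{pr}}\in L_1(\mathcal{H})_{\mathbb{R}}$ positive, and let $H$, $\mathcal{C}_{\mathrm{pos}}$, $\mathcal{E}$, $R(\cdot\Vert\cdot)$, $\mathscr{C}_r$, $\mathscr{P}_r$, $\mathscr{F}$, $\mathcal{L}_f$ and the sequences $(\lambda_i)_i\in\ell^2((-1,0])$, $(w_i)_i\subset\operatorname{ran}\mathcal{C}_{\mathrm{pr}}^{1/2}$ be as defined in the context. Let $r\in\mathbb{N}$, $r\le n$, and define $$\mathcal{P}^{\mathrm{opt}}_r:=\mathcal{C}_{\mathrm{pr}}^{-1}+\sum_{i=1}^r\frac{-\lambda_i}{1+\lambda_i}(\mathcal{C}_{\mathrm{pr}}^{-1/2}w_i)\otimes(\mathcal{C}_{\mathrm{pr}}^{-1/2}w_i),\qquad \mathcal{C}^{\mathrm{opt}}_r:=\mathcal{C}_{\mathrm{pr}}-\sum_{i=1}^r(-\lambda_i)(\mathcal{C}_{\mathrm{pr}}^{1/2}w_i)\otimes(\mathcal{C}_{\mathrm{pr}}^{1/2}w_i).$$ Then: (1) $\mathcal{P}^{\mathrm{opt}}_r\in\mathscr{P}_r$ and, for every $f\in\mathscr{F}$, $\mathcal{L}_f(\mathcal{C}_{\mathrm{pos}}\Vert(\mathcal{P}^{\mathrm{opt}}_r)^{-1})=\min\{\mathcal{L}_f(\mathcal{C}_{\mathrm{pos}}\Vert\mathcal{P}^{-1}):\mathcal{P}\in\mathscr{P}_r\}$.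 (2) $\mathcal{C}^{\mathrm{opt}}_r\in\mathscr{C}_r$ and, for every $f\in\mathscr{F}$, $\mathcal{L}_f(\mathcal{C}_{\mathrm{pos}}\Vert\mathcal{C}^{\mathrm{opt}}_r)=\min\{\mathcal{L}_f(\mathcal{C}_{\mathrm{pos}}\Vert\mathcal{C}):\mathcal{C}\in\mathscr{C}_r\}$. (3) $\mathcal{P}^{\mathrm{opt}}_r$ and $\mathcal{C}^{\mathrm{opt}}_r$ are inverses of each other. (4) For every $f\in\mathscr{F}$, the minimal loss is $\mathcal{L}_f(\mathcal{C}_{\mathrm{pos}}\Vert\mathcal{C}^{\mathrm{opt}}_r)=\sum_{i>r}f(\lambda_i)$. (5) $\mathcal{P}^{\mathrm{opt}}_r$ is the unique element of $\mathscr{P}_r$ with the property in (1), and $\mathcal{C}^{\mathrm{opt}}_r$ is the unique element of $\mathscr{C}_r$ with the property in (2), if and only if the following holds: $\lambda_{r+1}=0$ or $\lambda_r<\lambda_{r+1}$.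
   Context: Notation: $\mathcal{B}(\cdot,\cdot)$ denotes bounded linear operators; $L_1(\mathcal{H})_{\mathbb{R}}$, $L_2(\mathcal{H})_{\mathbb{R}}$ the self-adjoint trace-class, resp. Hilbert--Schmidt, operators. $T\ge0$, resp. $T>0$ (positive), means $\langle Th,h\rangle\ge0$, resp. $>0$, for all $h\neq0$; $T^{1/2}$ is the nonnegative self-adjoint square root; $\mathcal{C}^{-1}$, $\mathcal{C}^{-1/2}$ are defined on $\operatorname{ran}\mathcal{C}$, $\operatorname{ran}\mathcal{C}^{1/2}$. $k\otimes h$ is the operator $\tilde h\mapsto\langle h,\tilde h\rangle k$. $\ell^2(I)$ denotes the square-summable sequences with values in $I$. $\dim\mathcal{H}$ may be finite or infinite. Setting: $H:=G^*\mathcal{C}_{\mathrm{obs}}^{-1}G$. The posterior covariance for prior $\mathcal{N}(0,\mathcal{C}_{\mathrm{pr}})$ and data $Y=GX+\zeta$, $\zeta\sim\mathcal{N}(0,\mathcal{C}_{\mathrm{obs}})$ independent of $X$, is $\mathcal{C}_{\mathrm{pos}}=\mathcal{C}_{\mathrm{pr}}-\mathcal{C}_{\mathrm{pr}}G^*(\mathcal{C}_{\mathrm{obs}}+G\mathcal{C}_{\mathrm{pr}}G^* )^{-1}G\mathcal{C}_{\mathrm{pr}}$. It is positive, self-adjoint and trace-class, $\operatorname{ran}\mathcal{C}_{\mathrm{pos}}=\operatorname{ran}\mathcal{C}_{\mathrm{pr}}$, $\mathcal{C}_{\mathrm{pos}}^{-1}=\mathcal{C}_{\mathrm{pr}}^{-1}+H$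 on $\operatorname{ran}\mathcal{C}_{\mathrm{pr}}$, and $\operatorname{ran}\mathcal{C}_{\mathrm{pos}}^{1/2}=\operatorname{ran}\mathcal{C}_{\mathrm{pr}}^{1/2}$. $\mathcal{E}$ is the set of covariances $\mathcal{C}\in L_1(\mathcal{H})_{\mathbb{R}}$, $\mathcal{C}\ge0$, such that $\mathcal{N}(m,\mathcal{C})$ is equivalent (mutually absolutely continuous) to $\mathcal{N}(m,\mathcal{C}_{\mathrm{pos}})$ (the condition does not depend on $m\in\mathcal{H}$; the paper takes $m$ the posterior mean). For $\mathcal{C}_1,\mathcal{C}_2\in\mathcal{E}$ the operator $\mathcal{C}_1^{-1/2}\mathcal{C}_2^{1/2}$ is bounded and invertible, and $R(\mathcal{C}_2\Vert\mathcal{C}_1):=(\mathcal{C}_1^{-1/2}\mathcal{C}_2^{1/2})(\mathcal{C}_1^{-1/2}\mathcal{C}_2^{1/2})^*-I\in L_2(\mathcal{H})_{\mathbb{R}}$ has eigenvalues in $(-1,\infty)$. Approximation classes: $\mathscr{C}_r:=\{\mathcal{C}_{\mathrm{pr}}-KK^*:\ K\in\mathcal{B}(\mathbb{R}^r,\mathcal{H}),\ \operatorname{ran}K\subset\operatorname{ran}\mathcal{C}_{\mathrm{pr}},\ \mathcal{C}_{\mathrm{pr}}-KK^*>0\}$ and $\mathscr{P}_r:=\{\mathcal{C}_{\mathrm{pr}}^{-1}+UU^*:\ U\in\mathcal{B}(\mathbb{R}^r,\mathcal{H})\}$, where $\mathcal{C}_{\mathrm{pr}}^{-1}+UU^*$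 has domain $\operatorname{ran}\mathcal{C}_{\mathrm{pr}}$. It is known that $\mathscr{C}_r\subset\mathcal{E}$ and $\{\mathcal{P}^{-1}:\mathcal{P}\in\mathscr{P}_r\}=\mathscr{C}_r$. Losses: $\mathscr{F}$ is the set of $f\in C^1((-1,\infty))$ with $f(0)=0$, $xf'(x)>0$ for $x\ne0$, $\lim_{x\to\infty}f(x)=\infty$, and $f'$ Lipschitz at $0$ (i.e. Lipschitz continuous on some neighbourhood of $0$). For $f\in\mathscr{F}$ and $\mathcal{C}_1,\mathcal{C}_2\in\mathcal{E}$, $\mathcal{L}_f(\mathcal{C}_2\Vert\mathcal{C}_1):=\sum_i f(\Lambda_i(R(\mathcal{C}_2\Vert\mathcal{C}_1)))$, where $(\Lambda_i(T))_i$ denotes the eigenvalues of $T$ with multiplicity. Sequences: $(\lambda_i)_i\in\ell^2((-1,0])$ is nondecreasing with exactly $\operatorname{rank}(H)$ nonzero elements, and $(w_i)_i$, $(v_i)_i$ are orthonormal bases of $\mathcal{H}$ contained in $\operatorname{ran}\mathcal{C}_{\mathrm{pr}}^{1/2}$, with $v_i=\sqrt{1+\lambda_i}\,\mathcal{C}_{\mathrm{pos}}^{-1/2}\mathcal{C}_{\mathrm{pr}}^{1/2}w_i$, such that $R(\mathcal{C}_{\mathrm{pos}}\Vert\mathcal{C}_{\mathrm{pr}})=\sum_i\lambda_iw_i\otimes w_i$, $\mathcal{C}_{\mathrm{pr}}^{1/2}H\mathcal{C}_{\mathrm{pr}}^{1/2}=\sum_i\frac{-\lambda_i}{1+\lambda_i}w_i\otimes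 w_i$, $\mathcal{C}_{\mathrm{pos}}^{1/2}H\mathcal{C}_{\mathrm{pos}}^{1/2}=\sum_i(-\lambda_i)v_i\otimes v_i$ and $\mathcal{C}_{\mathrm{pos}}^{1/2}\mathcal{C}_{\mathrm{pr}}^{-1/2}w_i=(1+\lambda_i)\mathcal{C}_{\mathrm{pos}}^{-1/2}\mathcal{C}_{\mathrm{pr}}^{1/2}w_i$ for all $i$ (such sequences exist). If $\dim\mathcal{H}<\infty$, put $\lambda_i:=0$ for $i>\dim\mathcal{H}$ and omit terms with $i>\dim\mathcal{H}$ in the sums over $w_i$. *)

(* Defs.v *)
From HB Require Import structures.
From mathcomp Require Import all_boot all_order all_algebra.
From mathcomp Require Import all_classical all_reals all_analysis.

Set Implicit Arguments.
Unset Strict Implicit.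
Unset Printing Implicit Defensive.

Import Order.TTheory GRing.Theory Num.Theory.
Import numFieldNormedType.Exports.

Local Open Scope classical_set_scope.
Local Open Scope ring_scope.

(* MathComp puts the sup norm on ['cV[R]_n]; the Euclidean structure of R^n,
   with respect to which adjoints and positivity are taken, is this form.
   Boundedness of linear maps does not distinguish the two norms. *)
Definition euclid (R : realType) (n : nat) (x y : 'cV[R]_n) : R :=
  \sum_i x i 0 * y i 0.

Section euclid_dot.
Context (R : realType) (n : nat).

Let euclidC (x y : 'cV[R]_n) :
  euclid x y = (-1) ^+ false * idfun (euclid y x).
Proof. by rewrite mul1r; apply: eq_bigr => i _; rewrite mulrC. Qed.

Let euclidl (y : 'cV[R]_n) : GRing.linear_for *%R (@euclid R n ^~ y).
Proof.
move=> a u v; rewrite /euclid mulr_sumr -big_split /=.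
by apply: eq_bigr => i _; rewrite !mxE mulrDl mulrA.
Qed.

Let euclidr (x : 'cV[R]_n) : GRing.linear_for (idfun \; *%R) (@euclid R n x).
Proof.
move=> a u v; rewrite !(euclidC x) /= !mul1r.
by rewrite euclidl.
Qed.

Let euclid_gt0 (x : 'cV[R]_n) : x != 0 -> 0 < euclid x x.
Proof.
move=> x0; rewrite lt_neqAle eq_sym sumr_ge0 ?andbT; last first.
  by move=> i _; rewrite -expr2 sqr_ge0.
apply: contra x0; rewrite psumr_eq0 => [|i _]; last by rewrite -expr2 sqr_ge0.
move=> /allP x0; apply/eqP/colP => i; rewrite mxE; apply/eqP.
by have := x0 i (mem_index_enum _); rewrite mulf_eq0 orbb.
Qed.

HB.instance Definition _ := @bilinear_isBilinear.Build R 'cV[R]_n 'cV[R]_n R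
  *%R (idfun \; *%R) (@euclid R n) (euclidl, euclidr).
HB.instance Definition _ := @isHermitianSesquilinear.Build R 'cV[R]_n
  false idfun (@euclid R n) euclidC.
HB.instance Definition _ := @isDotProduct.Build R 'cV[R]_n
  (@euclid R n) euclid_gt0.
End euclid_dot.

Definition euclidean (R : realType) (n : nat) : {dot 'cV[R]_n for idfun} :=
  @euclid R n.

Section operators.
Context (R : realType).

Definition hilbert (H : completeNormedModType R) (dot : {dot H for idfun}) :=
  forall x : H, `|x| = Num.sqrt (dot x x).

Definition separable (T : topologicalType) :=
  exists D : set T, countable D /\ dense D.

Definition bounded_operator (U V : normedModType R) (A : U -> V) :=
  linear A /\ exists M : R, forall x, `|A x| <= M * `|x|.

(* The adjoint, total by choice; it is the usual one as soon as for every [y]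
   there is a representing vector, e.g. if [A] is bounded and [U] complete. *)
Definition adjoint (U V : lmodType R) (dU : {dot U for idfun})
    (dV : {dot V for idfun}) (A : U -> V) : V -> U :=
  fun y => xget 0 [set x | forall z, dV (A z) y = dU z x].

(* The inverse of an injective operator, defined on [range A] (and 0 outside). *)
Definition op_inv (U V : lmodType R) (A : U -> V) : V -> U :=
  fun y => xget 0 [set x | A x = y].

Definition selfadjoint (V : lmodType R) (d : {dot V for idfun}) (A : V -> V) :=
  forall x y, d (A x) y = d x (A y).

Definition nonnegative (V : lmodType R) (d : {dot V for idfun}) (A : V -> V) :=
  forall x, x != 0 -> 0 <= d (A x) x.

Definition positive (V : lmodType R) (d : {dot V for idfun}) (A : V -> V) :=
  forall x, x != 0 -> 0 < d (A x) x.

(* [has_rank A k] : the range of [A] has a basis of [k] vectors. *)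
Definition has_rank (U V : lmodType R) (A : U -> V) (k : nat) :=
  exists b : 'I_k -> V,
    (forall c : 'I_k -> R, \sum_i c i *: b i = 0 -> forall i, c i = 0) /\
    range A = [set y | exists c : 'I_k -> R, y = \sum_i c i *: b i].

(* Possibly unbounded operators on [V] are represented by their graphs. *)
Definition op_graph (V : lmodType R) (A : V -> V) : set (V * V) :=
  [set p | p.2 = A p.1].

Definition graph_inv (V : lmodType R) (P : set (V * V)) : set (V * V) :=
  [set p | P (p.2, p.1)].

Definition graph_fun (V : lmodType R) (P : set (V * V)) : V -> V :=
  fun x => xget 0 [set y | P (x, y)].

End operators.

Section hilbert_operators.
Context (R : realType) (H : completeNormedModType R) (dot : {dot H for idfun}).

Definition tensor (k h : H) : H -> H := fun x => dot h x *: k.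

Definition sqrt_op (C : H -> H) : H -> H :=
  xget (fun=> 0) [set S | [/\ bounded_operator S, selfadjoint dot S,
    nonnegative dot S & S \o S = C]].

(* Hilbert dimensions are [Some N] or [None] (infinite); families indexed by
   [1 <= i <= dim] are functions on [nat], shifted to start at 0, of which only
   the values at the [i] with [below d i] matter. *)
Definition below (d : option nat) (i : nat) : bool :=
  if d is Some N then (i < N)%N else true.

Definition orthonormal_basis (d : option nat) (e : nat -> H) :=
  (forall i j, below d i -> below d j -> dot (e i) (e j) = (i == j)%:R) /\
  dense [set x | exists (k : nat) (c : nat -> R),
    x = \sum_(i < k | below d i) c i *: e i].

(* [T] is the (pointwise convergent) sum of the [a_i (e_i \otimes e_i)]. *)
Definition diagonal_sum (d : option nat) (a : nat -> R) (e : nat -> H)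
    (T : H -> H) :=
  forall x, (fun k => \sum_(i < k | below d i) a i *: tensor (e i) (e i) x)
    @ \oo --> T x.

Definition trace_class (T : H -> H) :=
  bounded_operator T /\ exists d e, orthonormal_basis d e /\
    cvgn (fun k => \sum_(i < k | below d i)
      dot (sqrt_op (adjoint dot dot T \o T) (e i)) (e i)).

(* [\sum_i f (Lambda_i T)] over the eigenvalues of the diagonalizable operator
   [T], repeated according to their multiplicities. *)
Definition spectral_sum (f : R -> R) (T : H -> H) : R :=
  xget 0 [set s | exists d Lambda e, [/\ orthonormal_basis d e,
    forall i, below d i -> T (e i) = Lambda i *: e i &
    (fun k => \sum_(i < k | below d i) f (Lambda i)) @ \oo --> s]].

(* [relative_op C2 C1] is R(C2 || C1), in the same order of the arguments. *)
Definition relative_op (C2 C1 : H -> H) : H -> H :=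
  let A := op_inv (sqrt_op C1) \o sqrt_op C2 in
  fun x => (A \o adjoint dot dot A) x - x.

Definition loss (f : R -> R) (C2 C1 : H -> H) : R :=
  spectral_sum f (relative_op C2 C1).

End hilbert_operators.

(* The class of losses; only the values of [f] on ]-1, +oo[ matter. *)
Record loss_class (R : realType) (f : R -> R) : Prop := LossClass {
  loss_derivable : forall x : R, -1 < x -> derivable f x 1;
  loss_C1 : forall x : R, -1 < x -> {for x, continuous (derive1 f)};
  loss_at0 : f 0 = 0;
  loss_sign : forall x : R, -1 < x -> x != 0 -> 0 < x * derive1 f x;
  loss_infty : f x @[x --> +oo] --> +oo;
  loss_lipschitz0 : exists2 U : set R,
    nbhs 0 U & [lipschitz (derive1 f) x | x in U]
}.

Section inverse_problem.
Context (R : realType) (H : completeNormedModType R) (dot : {dot H for idfun}).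
Context (n : nat) (G : H -> 'cV[R]_n) (Cobs : 'cV[R]_n -> 'cV[R]_n).
Context (Cpr : H -> H).

Local Notation "A ^-1/2" := (op_inv (sqrt_op dot A))
  (at level 2, format "A ^-1/2").
Local Notation "A ^1/2" := (sqrt_op dot A) (at level 2, format "A ^1/2").
Local Notation Gadj := (adjoint dot (euclidean R n) G).

Definition hessian : H -> H := Gadj \o op_inv Cobs \o G.

Definition Cpos : H -> H := fun x =>
  Cpr x - (Cpr \o Gadj \o op_inv (fun y => Cobs y + (G \o Cpr \o Gadj) y)
    \o G \o Cpr) x.

(* K K^* for K defined on R^r *)
Definition gram (r : nat) (K : 'cV[R]_r -> H) : H -> H :=
  K \o adjoint (euclidean R r) dot K.

Definition cov_class (r : nat) : set (H -> H) :=
  [set C | exists K : 'cV[R]_r -> H, [/\ bounded_operator K,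
    range K `<=` range Cpr,
    C = (fun x => Cpr x - gram K x) &
    positive dot C]].

(* Cpr^{-1} + B, with domain [range Cpr] *)
Definition prior_precision_plus (B : H -> H) : set (H * H) :=
  [set p | range Cpr p.1 /\ p.2 = op_inv Cpr p.1 + B p.1].

Definition prec_class (r : nat) : set (set (H * H)) :=
  [set P | exists2 U : 'cV[R]_r -> H, bounded_operator U &
    P = prior_precision_plus (gram U)].

Record spectral_sequences (d : option nat) (lam : nat -> R) (w v : nat -> H) :
    Prop := SpectralSequences {
  lam_range : forall i, -1 < lam i <= 0;
  lam_l2 : cvgn (series (fun i => lam i ^+ 2));
  lam_nondecreasing : forall i j, (i <= j)%N -> lam i <= lam j;
  lam_rank : exists2 k, has_rank hessian k &
    ([set i | lam i != 0%R] #= `I_k)%card;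
  lam_beyond : forall i, ~~ below d i -> lam i = 0;
  w_basis : orthonormal_basis dot d w;
  v_basis : orthonormal_basis dot d v;
  w_range : forall i, below d i -> range Cpr^1/2 (w i);
  v_range : forall i, below d i -> range Cpr^1/2 (v i);
  v_def : forall i, below d i ->
    v i = Num.sqrt (1 + lam i) *: Cpos^-1/2 (Cpr^1/2 (w i));
  relative_diag : diagonal_sum dot d lam w (relative_op dot Cpos Cpr);
  prior_diag : diagonal_sum dot d (fun i => - lam i / (1 + lam i)) w
    (Cpr^1/2 \o hessian \o Cpr^1/2);
  posterior_diag : diagonal_sum dot d (fun i => - lam i) v
    (Cpos^1/2 \o hessian \o Cpos^1/2);
  w_intertwine : forall i, below d i ->
    Cpos^1/2 (Cpr^-1/2 (w i)) = (1 + lam i) *: Cpos^-1/2 (Cpr^1/2 (w i))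
}.

Definition Popt (d : option nat) (lam : nat -> R) (w : nat -> H) (r : nat) :
    set (H * H) :=
  prior_precision_plus (fun x => \sum_(i < r | below d i)
    (- lam i / (1 + lam i)) *:
      tensor dot (Cpr^-1/2 (w i)) (Cpr^-1/2 (w i)) x).

Definition Copt (d : option nat) (lam : nat -> R) (w : nat -> H) (r : nat) :
    H -> H :=
  fun x => Cpr x - \sum_(i < r | below d i)
    (- lam i) *: tensor dot (Cpr^1/2 (w i)) (Cpr^1/2 (w i)) x.

(* [C] minimizes, over the covariances in [cov_class r], all the losses
   simultaneously; likewise for precisions. *)
Definition optimal_cov (r : nat) (C : H -> H) :=
  cov_class r C /\ forall f, loss_class f ->
    forall C', cov_class r C' -> loss dot f Cpos C <= loss dot f Cpos C'.

Definition optimal_prec (r : nat) (P : set (H * H)) :=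
  prec_class r P /\ forall f, loss_class f ->
    forall P', prec_class r P' ->
      loss dot f Cpos (graph_fun (graph_inv P))
        <= loss dot f Cpos (graph_fun (graph_inv P')).

End inverse_problem.

(* Main.v *)
(** Write S0 = Cpr^(1/2).  The spectral data give
    Cpos = Cpr + sum_i lambda_i (S0 w_i) (x) (S0 w_i), and both approximation
    classes, diagonalized in finite rank, consist of the operators
    C = Cpr - sum_(k < p) sigma_k (S0 u_k) (x) (S0 u_k) with p <= r, the u_k
    orthonormal in ran S0 and 0 <= sigma_k < 1 (resp. of their inverses).

    For such a C, the operator T = R(Cpos || C) has finite rank and satisfies
    <T S y, S y> = <Cpos y, y> - <C y, y> with S = C^(1/2).  Vectors y for which
    S0 y lies in the span of w_1, ..., w_(r+k) and is orthogonal to the u_k have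
    |S y| = |S0 y|, so that the Rayleigh quotient of T at S y is at most
    lambda_(r+k).  Picking such vectors orthogonal to the eigenvectors already
    found, one exhibits eigenvalues mu_(j_k) <= lambda_(r+k) of T, j_k distinct;
    since every loss f is nonnegative and decreases on ]-1, 0], the loss of C is
    at least sum_(i > r) f(lambda_i), the value attained by the truncation.

    For uniqueness it suffices to look at f(x) = x^2, whose loss is the squared
    Hilbert-Schmidt norm of T: equality forces T to be diagonal in an
    orthonormal family of such test vectors, and the spectral gap forces these
    to span the w_i with i > r. *)
Require Import Defs.
From HB Require Import structures.
From mathcomp Require Import all_boot all_order all_algebra.
From mathcomp Require Import all_classical all_reals all_analysis.
From mathcomp Require Import complex ring lra.

Set Implicit Arguments.
Unset Strict Implicit.
Unset Printing Implicit Defensive.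

Import Order.TTheory GRing.Theory Num.Theory.
Import numFieldNormedType.Exports.

Local Open Scope classical_set_scope.
Local Open Scope ring_scope.

(** * Inner products and orthonormal families *)

(** The obstacle is that C^(-1/2) is unbounded. Two facts keep the argument finite-dimensional. The
    lambda_i vanish from some index m on, so the posterior is itself a finite-rank update of [Cpr];
    and all updates concerned have quadratic forms comparable to that of [Cpr], so that Douglas'
    lemma makes A = C1^(-1/2) C2^(1/2) everywhere defined and bounded. Then T enters through S1 T S1
    = C2 - C1, its symmetry and T + 1 = A A^*, and diagonalization only concerns real symmetric
    matrices. The formula of [Cpos] is never expanded: the relation between v_i and w_i gives the
    action of its square root on a basis. [op_inv], [sqrt_op] and [adjoint] take default values when
    nothing qualifies, so existence has to be established: by a monotone iteration for square roots,
    by Riesz for adjoints. The count behind the lower bound: r + k + 1 coordinates along the w_i,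
    against p <= r conditions imposed by the competitor and k by the vectors already found. *)

Section dot_theory.
Context (R : realType) (V : lmodType R) (dot : {dot V for idfun}).
Local Notation "''[' x , y ]" := (dot x y).
Implicit Types x y z : V.

Lemma dotC x y : '[x, y] = '[y, x].
Proof. by rewrite hermC expr0 mul1r. Qed.

Lemma dotDl x y z : '[x + y, z] = '[x, z] + '[y, z]. Proof. exact: linearDl. Qed.
Lemma dotDr x y z : '[z, x + y] = '[z, x] + '[z, y]. Proof. exact: linearDr. Qed.
Lemma dotBl x y z : '[x - y, z] = '[x, z] - '[y, z]. Proof. exact: linearBl. Qed.
Lemma dotBr x y z : '[z, x - y] = '[z, x] - '[z, y]. Proof. exact: linearBr. Qed.
Lemma dotNl x y : '[- x, y] = - '[x, y]. Proof. exact: linearNl. Qed.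
Lemma dotNr x y : '[x, - y] = - '[x, y]. Proof. exact: linearNr. Qed.
Lemma dot0l x : '[0, x] = 0. Proof. exact: linear0l. Qed.
Lemma dot0r x : '[x, 0] = 0. Proof. exact: linear0r. Qed.
Lemma dotZl a x y : '[a *: x, y] = a * '[x, y]. Proof. exact: linearZl_LR. Qed.
Lemma dotZr a x y : '[x, a *: y] = a * '[x, y].
Proof. by rewrite dotC dotZl dotC. Qed.

Lemma dot_suml (I : Type) (s : seq I) (P : pred I) (F : I -> V) y :
  '[\sum_(i <- s | P i) F i, y] = \sum_(i <- s | P i) '[F i, y].
Proof. exact: linear_sumlz. Qed.

Lemma dot_sumr (I : Type) (s : seq I) (P : pred I) (F : I -> V) y :
  '[y, \sum_(i <- s | P i) F i] = \sum_(i <- s | P i) '[y, F i].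
Proof. exact: linear_sumr. Qed.

Lemma dot_gt0 x : x != 0 -> 0 < '[x, x]. Proof. exact: neq0_dnorm_gt0. Qed.

Lemma dot_ge0 x : 0 <= '[x, x].
Proof.
by have [->|/dot_gt0/ltW//] := eqVneq x 0; rewrite dot0l.
Qed.

Lemma dot_eq0 x : '[x, x] = 0 -> x = 0.
Proof. by move=> h; apply/eqP/contraT => /dot_gt0; rewrite h ltxx. Qed.

Lemma dot_inj x y : (forall z, '[x, z] = '[y, z]) -> x = y.
Proof.
move=> h; apply/eqP; rewrite -subr_eq0; apply/eqP/dot_eq0.
by rewrite dotBl h subrr.
Qed.

Lemma cauchy_schwarz x y : '[x, y] ^+ 2 <= '[x, x] * '[y, y].
Proof.
have [->|y0] := eqVneq y 0; first by rewrite !dot0r expr0n mulr0.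
have yy := dot_gt0 y0.
have := dot_ge0 ('[y, y] *: x - '[x, y] *: y).
rewrite !(dotBl, dotBr, dotZl, dotZr) (dotC y x).
set a := '[x, x]; set b := '[x, y]; set c := '[y, y].
move=> h; rewrite -subr_ge0 -(pmulr_rge0 _ yy) -/c.
by apply: le_trans h _; rewrite le_eqVlt; apply/orP; left; apply/eqP; ring.
Qed.

Definition orthonormal_upto (p : nat) (u : nat -> V) :=
  forall i j, (i < p)%N -> (j < p)%N -> '[u i, u j] = (i == j)%:R.

Section orthonormal.
Variables (p : nat) (u : nat -> V).
Hypothesis up : orthonormal_upto p u.

Lemma orthonormal_sum (c : nat -> R) (k : nat) :
  (k < p)%N -> '[\sum_(i < p) c i *: u i, u k] = c k.
Proof.
move=> kp; rewrite dot_suml (bigD1 (Ordinal kp))//= dotZl up// eqxx mulr1.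
rewrite big1 ?addr0// => i ik.
by rewrite dotZl up// (_ : (i == k :> nat) = false) ?mulr0//; exact/negbTE.
Qed.

Lemma orthonormal_dot (c : nat -> R) x :
  '[\sum_(i < p) c i *: u i, x] = \sum_(i < p) c i * '[u i, x].
Proof. by rewrite dot_suml; apply: eq_bigr => i _; rewrite dotZl. Qed.

Lemma orthonormal_sum_sum (c b : nat -> R) :
  '[\sum_(i < p) c i *: u i, \sum_(i < p) b i *: u i] =
  \sum_(i < p) c i * b i.
Proof.
rewrite orthonormal_dot; apply: eq_bigr => i _.
by rewrite dotC orthonormal_sum.
Qed.

Lemma pythagoras (c : nat -> R) x :
  '[x - \sum_(i < p) c i *: u i, x - \sum_(i < p) c i *: u i] =
  '[x, x] - \sum_(i < p) '[x, u i] ^+ 2 +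
  \sum_(i < p) (c i - '[x, u i]) ^+ 2.
Proof.
rewrite !(dotBl, dotBr) orthonormal_sum_sum (dotC x) orthonormal_dot.
rewrite -[in RHS]addrA -[in LHS]addrA; congr (_ + _).
rewrite opprB addrA -!sumrN -!big_split /=; apply: eq_bigr => i _.
rewrite (dotC (u i)); ring.
Qed.

Lemma bessel x : \sum_(i < p) '[x, u i] ^+ 2 <= '[x, x].
Proof.
have := dot_ge0 (x - \sum_(i < p) '[x, u i] *: u i).
rewrite (pythagoras (fun i => '[x, u i])).
rewrite [X in _ + X]big1 ?addr0 ?subr_ge0// => i _.
by rewrite subrr expr0n.
Qed.

Lemma bessel_eq x : \sum_(i < p) '[x, u i] ^+ 2 = '[x, x] ->
  x = \sum_(i < p) '[x, u i] *: u i.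
Proof.
move=> h; apply/eqP; rewrite -subr_eq0; apply/eqP/dot_eq0.
rewrite (pythagoras (fun i => '[x, u i])) h subrr add0r big1// => i _.
by rewrite subrr expr0n.
Qed.

Lemma span_bessel x (c : nat -> R) : x = \sum_(i < p) c i *: u i ->
  x = \sum_(i < p) '[x, u i] *: u i.
Proof.
move=> xE; rewrite {1}xE; apply: eq_bigr => i _.
by rewrite xE orthonormal_sum.
Qed.

End orthonormal.

End dot_theory.

(** * Hilbert spaces *)

Section hilbert_theory.
Context (R : realType) (H : completeNormedModType R) (dot : {dot H for idfun}).
Hypothesis hdot : hilbert dot.
Local Notation "''[' x , y ]" := (dot x y).
Implicit Types x y z : H.

Lemma norm_dotE x : `|x| ^+ 2 = '[x, x].
Proof. by rewrite hdot sqr_sqrtr// dot_ge0. Qed.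

Lemma norm_dot_le x y : `|'[x, y]| <= `|x| * `|y|.
Proof.
rewrite -ler_sqr ?nnegrE ?mulr_ge0//.
by rewrite real_normK ?num_real// (le_trans (cauchy_schwarz dot x y))// -!norm_dotE exprMn.
Qed.

Lemma ler_norm_dot x (M : R) : 0 <= M -> (`|x| <= M) = ('[x, x] <= M ^+ 2).
Proof. by move=> M0; rewrite -norm_dotE ler_sqr ?nnegrE. Qed.

Lemma cvg_dotl (F : set_system nat) {FF : Filter F} (x : nat -> H) (l y : H) :
  x @ F --> l -> '[x k, y] @[k --> F] --> '[l, y].
Proof.
move=> xl; apply/cvgrPdist_le => e e0; near=> k.
rewrite -dotBl; apply: le_trans (norm_dot_le _ _) _.
have y1 : 0 < `|y| + 1 by rewrite ltr_wpDl.
have : `|l - x k| <= e / (`|y| + 1).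
  by near: k; apply: cvgr_dist_le => //; rewrite divr_gt0.
rewrite ler_pdivlMr// => h; apply: le_trans h.
by rewrite ler_wpM2l// lerDl.
Unshelve. all: by end_near. Qed.

Lemma cvg_dotr (F : set_system nat) {FF : Filter F} (x : nat -> H) (l y : H) :
  x @ F --> l -> '[y, x k] @[k --> F] --> '[y, l].
Proof.
move=> xl; rewrite (dotC _ y l).
by under eq_fun do rewrite dotC; exact: cvg_dotl.
Qed.

Lemma cauchy_dot (x : nat -> H) (b : nat -> R) :
  (forall k l, (k <= l)%N -> '[x l - x k, x l - x k] <= b k) ->
  b @ \oo --> 0 -> cvgn x.
Proof.
move=> xb b0; apply/cauchy_cvgP/cauchy_exP => e e0.
near \oo => k; exists (x k).
change (\forall l \near \oo, ball (x k) e (x l)).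
near=> l; rewrite -ball_normE /= distrC.
apply: (@le_lt_trans _ _ (e / 2)); last by rewrite ltr_pdivrMr// mulr_natr mulr2n ltrDl.
rewrite ler_norm_dot ?divr_ge0 ?(ltW e0)//.
apply: (@le_trans _ _ (b k)); first by apply: xb; near: l; exact: nbhs_infty_ge.
near: k; have := @cvgr_dist_le _ _ _ _ _ _ _ b0 ((e / 2) ^+ 2).
have h : 0 < (e / 2) ^+ 2 by rewrite exprn_gt0 ?divr_gt0.
move=> /(_ _ h); apply: filterS => k /=; rewrite sub0r normrN.
exact/le_trans/ler_norm.
Unshelve. all: by end_near. Qed.

(* Minimizing |S y|^2 - 2 phi(y): the images under S of a minimizing sequence
   are Cauchy by the parallelogram law, and their limit represents phi.  The
   usual theorem is the case where S is the identity. *)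
Lemma riesz (V : lmodType R) (S : V -> H) (phi : V -> R) (M : R) :
  linear S -> linear_for *%R phi -> 0 <= M ->
  (forall y : V, `|phi y| <= M * `|S y|) ->
  exists2 u : H, `|u| <= M & forall y : V, phi y = '[u, S y].
Proof.
move=> linS linphi M0 phiM.
have SP a (y y' : V) : S (a *: y + y') = a *: S y + S y' by exact: linS.
have phiP a (y y' : V) : phi (a *: y + y') = a * phi y + phi y' by exact: linphi.
pose F (y : V) := '[S y, S y] - 2 * phi y.
have F0 (y : V) : - M ^+ 2 <= F y.
  have := phiM y; rewrite /F -norm_dotE => /(le_trans (ler_norm _)) h.
  have := sqr_ge0 (`|S y| - M); rewrite sqrrB => h2; nra.
pose E := range F.
have hE : has_inf E.
  split; first by exists (F 0), 0.
  by exists (- M ^+ 2) => _ [y _ <-].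
have mid (y y' : V) : '[S y' - S y, S y' - S y] <= 2 * (F y - inf E) + 2 * (F y' - inf E).
  (* The midpoint of y and y', in a shape to which [SP] and [phiP] apply twice: F there equals the
     mean of F y and F y' minus |S y' - S y|^2 / 4. *)
  have : inf E <= F (2^-1 *: y + (2^-1 *: y' + 0)).
    by apply: ge_inf; [case: hE|exists (2^-1 *: y + (2^-1 *: y' + 0))].
  have S0 : S 0 = 0.
    have := SP 1 0 0; rewrite !scale1r addr0 => /eqP.
    by rewrite addrC -subr_eq subrr => /eqP.
  have phi0 : phi 0 = 0.
    have := phiP 1 0 0; rewrite scale1r mul1r addr0 => /eqP.
    by rewrite addrC -subr_eq subrr => /eqP.
  rewrite /F !SP !phiP S0 phi0 !addr0 !(dotDl, dotDr, dotNl, dotNr, dotZl, dotZr).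
  rewrite (dotC _ (S y')); move: (inf E) => i; lra.
have ex k : exists y : V, F y < inf E + (k.+1%:R)^-1.
  have [|_ [y _ <-] lty] := @inf_adherent _ E (k.+1%:R^-1) _ hE; first by rewrite invr_gt0.
  by exists y.
have [y yP] := choice ex.
have Sy : cvgn (S \o y).
  apply: (@cauchy_dot _ (fun k => 4 * harmonic k)) => [k l kl|]; last first.
    by rewrite -(mulr0 4); apply: cvgMl_tmp; exact: cvg_harmonic.
  apply: le_trans (mid (y k) (y l)) _; rewrite /harmonic /=.
  have := yP k; have := yP l.
  have : (l.+1%:R^-1 : R) <= k.+1%:R^-1 by rewrite lef_pV2 ?posrE// ler_nat.
  move: (inf E) (k.+1%:R^-1) (l.+1%:R^-1) (F (y k)) (F (y l)) => i a b c e; lra.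
pose u := limn (S \o y).
have uP (z : V) : phi z = '[u, S z].
  (* First variation: F (t z + y k) >= inf E > F (y k) - 1/(k+1), in the limit k -> oo. *)
  have key t : 0 <= t * (2 * ('[u, S z] - phi z)) + t ^+ 2 * '[S z, S z].
    have c1 : (fun k => k.+1%:R^-1 + 2 * (t * ('[S (y k), S z] - phi z)) +
         t ^+ 2 * '[S z, S z]) @ \oo -->
        0 + 2 * (t * ('[u, S z] - phi z)) + t ^+ 2 * '[S z, S z].
      apply: cvgD; last exact: cvg_cst.
      apply: cvgD; first exact: cvg_harmonic.
      apply: cvgMl_tmp; apply: cvgMl_tmp; apply: cvgB; last exact: cvg_cst.
      exact: (@cvg_dotl _ _ (S \o y) u).
    have -> : t * (2 * ('[u, S z] - phi z)) + t ^+ 2 * '[S z, S z] =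
      0 + 2 * (t * ('[u, S z] - phi z)) + t ^+ 2 * '[S z, S z] by ring.
    apply: (cvgr_to_ge c1); near=> k.
    have : inf E <= F (t *: z + y k).
      by apply: ge_inf; [case: hE|exists (t *: z + y k)].
    have := yP k; rewrite /F !SP !phiP !(dotDl, dotDr, dotZl, dotZr).
    rewrite (dotC _ (S z) (S (y k))); move: (inf E) (k.+1%:R^-1) => i b.
  move: '[S (y k), S (y k)] '[S (y k), S z] '[S z, S z] => a1 a2 a3; nra.
  apply/eqP; rewrite eq_sym -subr_eq0; apply/eqP.
  set a := '[u, S z] - phi z; set c := '[S z, S z] in key.
  have c0 : 0 <= c by exact: dot_ge0.
  (* The optimal t is - a / c; the shift by 1 covers c = 0 and still leaves a negative multiple of
     a^2. *)
  have := key (- a / (c + 1)).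
  have c1 : 0 < c + 1 by lra.
  have -> : - a / (c + 1) * (2 * ('[u, S z] - phi z)) + (- a / (c + 1)) ^+ 2 * c =
     - (a ^+ 2 * ((c + 2) / (c + 1) ^+ 2)).
    by rewrite -/a; field; apply/eqP; lra.
  rewrite oppr_ge0 pmulr_lle0 ?divr_gt0 ?exprn_gt0//; last lra.
  by move=> a0; apply/eqP; rewrite -sqrf_eq0 eq_le a0 sqr_ge0.
exists u => //.
(* |u|^2 is the limit of <u, S (y k)> = phi (y k) <= M |S (y k)|, hence at most M |u|. *)
have : '[u, u] <= M * `|u|.
  have c1 : '[u, S (y k)] @[k --> \oo] --> '[u, u] by exact: (@cvg_dotr _ _ (S \o y) u).
  have c2 : M * `|S (y k)| @[k --> \oo] --> M * `|u|.
    by apply: cvgMl_tmp; exact: (@cvg_norm _ _ _ _ _ (S \o y) u).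
  apply: ler_cvg_to c1 c2 _; near=> k.
  by rewrite -uP; apply: le_trans (ler_norm _) (phiM _).
rewrite -norm_dotE expr2; have [->|u0] := eqVneq u 0; first by rewrite normr0.
by rewrite ler_pM2r// normr_gt0.
Unshelve. all: by end_near. Qed.

End hilbert_theory.

Section linear_maps.
Context (R : realType) (U V : lmodType R) (A : U -> V).
Hypothesis linA : linear A.

Lemma linD x y : A (x + y) = A x + A y.
Proof. by have := linA 1 x y; rewrite !scale1r. Qed.

Lemma lin0 : A 0 = 0.
Proof. by apply: (addrI (A 0)); rewrite -linD !addr0. Qed.

Lemma linZ a x : A (a *: x) = a *: A x.
Proof. by have := linA a x 0; rewrite !addr0 lin0 addr0. Qed.

Lemma linN x : A (- x) = - A x.
Proof. by rewrite -scaleN1r linZ scaleN1r. Qed.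

Lemma linB x y : A (x - y) = A x - A y.
Proof. by rewrite linD linN. Qed.

Lemma lin_sum (I : Type) (s : seq I) (P : pred I) (F : I -> U) :
  A (\sum_(i <- s | P i) F i) = \sum_(i <- s | P i) A (F i).
Proof. by apply: (big_morph A); [exact: linD|exact: lin0]. Qed.

Lemma op_invK y : range A y -> A (op_inv A y) = y.
Proof. by move=> [x _ xy]; rewrite /op_inv; case: xgetP => //= /(_ x). Qed.

Lemma op_inv_eq x : (forall z, A z = 0 -> z = 0) -> op_inv A (A x) = x.
Proof.
move=> inj; apply/eqP; rewrite -subr_eq0; apply/eqP/inj.
by rewrite linB op_invK ?subrr//; exists x.
Qed.

Context (dU : {dot U for idfun}) (dV : {dot V for idfun}).

Lemma adjoint_eq y x :
  (forall z, dV (A z) y = dU z x) -> adjoint dU dV A y = x.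
Proof.
move=> h; rewrite /adjoint; case: xgetP => [x' _ /= h'|/= /(_ x)//].
by apply: (@dot_inj _ _ dU) => z; rewrite !(dotC _ _ z) -h -h'.
Qed.

End linear_maps.

(** * Square roots of nonnegative operators *)

Section square_root.
Context (R : realType) (H : completeNormedModType R) (dot : {dot H for idfun}).
Hypothesis hdot : hilbert dot.
Local Notation "''[' x , y ]" := (dot x y).
Implicit Types x y z : H.

Lemma cvg_dot (a b : nat -> H) x y :
  a @ \oo --> x -> b @ \oo --> y -> '[a k, b k] @[k --> \oo] --> '[x, y].
Proof.
move=> ax bY.
have E u v : '[u, v] = 4^-1 * (`|u + v| * `|u + v| - `|u - v| * `|u - v|).
  rewrite -!expr2 !(norm_dotE hdot) !(dotDl, dotDr, dotNl, dotNr) (dotC _ v u).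
  by field.
under eq_fun do rewrite E; rewrite E.
apply: cvgMl_tmp; apply: cvgB; apply: cvgM;
  solve [exact: cvg_norm (cvgD ax bY)|exact: cvg_norm (cvgB ax bY)].
Qed.

(* Nonnegativity of <D y, y> at y = x - D x. *)
Lemma nonneg_contraction (D : H -> H) : linear D -> selfadjoint dot D ->
  (forall x, 0 <= '[D x, x] <= '[x, x]) -> forall x, '[D x, D x] <= '[D x, x].
Proof.
move=> D_lin symD D01 x.
have CS t y : 0 <= '[D x, x] + t * (2 * '[D x, y]) + t ^+ 2 * '[D y, y].
  have /andP[+ _] := D01 (x + t *: y).
  rewrite (linD D_lin) (linZ D_lin) !(dotDl, dotDr, dotZl, dotZr).
  rewrite (symD y x) (dotC _ y (D x)) => h; apply: le_trans h _.
  by rewrite le_eqVlt; apply/orP; left; apply/eqP; ring.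
have := CS (-1) (D x); have /andP[_] := D01 (D x).
move: '[D x, D x] '[D (D x), D x] '[D x, x] => a b c; lra.
Qed.

(** * The square root of 1 - B for a symmetric B between 0 and 1 *)

Section contraction.
Variable B : H -> H.
Hypotheses (B_lin : linear B) (symB : selfadjoint dot B).
Hypothesis B01 : forall x, 0 <= '[B x, x] <= '[x, x].

Definition poly_op (p : {poly R}) x := \sum_(i < size p) p`_i *: iter i B x.

Lemma poly_opE k (p : {poly R}) x : (size p <= k)%N ->
  poly_op p x = \sum_(i < k) p`_i *: iter i B x.
Proof.
move=> pk; rewrite /poly_op (big_ord_widen _ (fun i => p`_i *: iter i B x) pk).
rewrite big_mkcond; apply: eq_bigr => i _; case: ltnP => // h.
by rewrite nth_default// scale0r.
Qed.

Lemma iter_lin i : linear (iter i B).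
Proof. by elim: i => [|i IH] a x y //=; rewrite IH B_lin. Qed.

Lemma iter_sym i : selfadjoint dot (iter i B).
Proof. by elim: i => [|i IH] x y //=; rewrite symB IH -iterSr. Qed.

Lemma poly_op_lin p : linear (poly_op p).
Proof.
move=> a x y; rewrite /poly_op scaler_sumr -big_split; apply: eq_bigr => i _ /=.
by rewrite iter_lin scalerDr !scalerA mulrC.
Qed.

Lemma poly_op_sym p : selfadjoint dot (poly_op p).
Proof.
move=> x y; rewrite /poly_op dot_suml dot_sumr; apply: eq_bigr => i _.
by rewrite dotZl dotZr iter_sym.
Qed.

Lemma poly_opD p q x : poly_op (p + q) x = poly_op p x + poly_op q x.
Proof.
rewrite (@poly_opE (maxn (size p) (size q)) (p + q)) ?size_polyD//.
rewrite (@poly_opE (maxn (size p) (size q)) p) ?leq_maxl//.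
rewrite (@poly_opE (maxn (size p) (size q)) q) ?leq_maxr//.
by rewrite -big_split; apply: eq_bigr => i _ /=; rewrite coefD scalerDl.
Qed.

Lemma poly_opZ a p x : poly_op (a *: p) x = a *: poly_op p x.
Proof.
rewrite (@poly_opE (size p) (a *: p)) ?size_scale_leq// /poly_op scaler_sumr.
by apply: eq_bigr => i _ /=; rewrite coefZ scalerA.
Qed.

Lemma poly_op0 x : poly_op 0 x = 0.
Proof. by rewrite /poly_op size_poly0 big_ord0. Qed.

Lemma poly_opC c x : poly_op c%:P x = c *: x.
Proof. by rewrite (@poly_opE 1) ?size_polyC_leq1// big_ord1 coefC. Qed.

Lemma poly_opMX p x : poly_op (p * 'X) x = poly_op p (B x).
Proof.
rewrite (@poly_opE (size p).+1 (p * 'X)); last first.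
  by rewrite (leq_trans (size_polyMleq _ _))// size_polyX addn2.
rewrite big_ord_recl coefMX eqxx scale0r add0r; apply: eq_bigr => i _.
by rewrite coefMX /= -iterSr.
Qed.

Lemma poly_opX x : poly_op 'X x = B x.
Proof. by rewrite -['X]mul1r poly_opMX poly_opC scale1r. Qed.

Lemma poly_opM p q x : poly_op (p * q) x = poly_op p (poly_op q x).
Proof.
elim/poly_ind: p x => [|p c IH] x; first by rewrite mul0r !poly_op0.
rewrite mulrDl !poly_opD mul_polyC poly_opZ poly_opC; congr (_ + _).
have -> : p * 'X * q = p * q * 'X by rewrite -!mulrA (mulrC q).
rewrite poly_opMX IH poly_opMX.
congr (poly_op p _).
rewrite /poly_op (lin_sum B_lin); apply: eq_bigr => i _.
by rewrite (linZ B_lin) -iterSr.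
Qed.

(** This cone of polynomials is stable under products, and p(B) >= 0 for its members. It stands in
    for the theorem that commuting nonnegative operators have a nonnegative product. *)
Definition nonneg_coefs (p : {poly R}) := forall i, 0 <= p`_i.

Lemma nonneg_coefsD p q :
  nonneg_coefs p -> nonneg_coefs q -> nonneg_coefs (p + q).
Proof. by move=> h h' i; rewrite coefD addr_ge0. Qed.

Lemma nonneg_coefsM p q :
  nonneg_coefs p -> nonneg_coefs q -> nonneg_coefs (p * q).
Proof. by move=> h h' i; rewrite coefM sumr_ge0// => j _; rewrite mulr_ge0. Qed.

Lemma nonneg_coefsZ a p : 0 <= a -> nonneg_coefs p -> nonneg_coefs (a *: p).
Proof. by move=> a0 h i; rewrite coefZ mulr_ge0. Qed.

(** By symmetry an even power gives |B^j x|^2 and an odd one <B y, y> with y = B^j x; B does not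
    increase norms by [nonneg_contraction]. *)
Lemma iter_ge0_le i x : 0 <= '[iter i B x, x] <= '[x, x].
Proof.
have even j y : '[iter j.*2 B y, y] = '[iter j B y, iter j B y].
  by rewrite -addnn iterD iter_sym.
have Ble y : '[B y, B y] <= '[y, y].
  have /andP[_] := B01 y; apply: le_trans.
  exact: nonneg_contraction.
have itle j y : '[iter j B y, iter j B y] <= '[y, y].
  by elim: j => [|j IH] //=; exact: le_trans (Ble _) IH.
rewrite -(odd_double_half i); case: odd; rewrite ?add0n ?add1n.
  rewrite iterS -addnn iterD -iterS iterSr iter_sym.
  have /andP[-> h] := B01 (iter i./2 B x).
  exact: le_trans h (itle _ _).
by rewrite even dot_ge0 itle.
Qed.

Lemma poly_op_ge0_le p x : nonneg_coefs p -> p.[1] <= 1 ->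
  0 <= '[poly_op p x, x] <= '[x, x].
Proof.
move=> p0 p1; rewrite /poly_op dot_suml; apply/andP; split.
  apply: sumr_ge0 => i _; rewrite dotZl mulr_ge0//.
  by have /andP[] := iter_ge0_le i x.
apply: le_trans (_ : p.[1] * '[x, x] <= _); last first.
  by rewrite ler_piMl// dot_ge0.
rewrite horner_coef mulr_suml; apply: ler_sum => i _.
rewrite dotZl expr1n mulr1 ler_wpM2l//.
by have /andP[] := iter_ge0_le i x.
Qed.

(* The iteration Y' = (B + Y^2) / 2, whose limit solves (1 - Y)^2 = 1 - B. *)
Fixpoint sqrt_poly (n : nat) : {poly R} :=
  if n is n'.+1 then 2^-1 *: ('X + sqrt_poly n' * sqrt_poly n') else 0.

Lemma sqrt_poly_ge0 n : nonneg_coefs (sqrt_poly n).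
Proof.
elim: n => [|n IH] /=; first by move=> i; rewrite coef0.
apply: nonneg_coefsZ => //; apply: nonneg_coefsD; last exact: nonneg_coefsM.
by move=> i; rewrite coefX ler0n.
Qed.

Lemma sqrt_poly_incr n : nonneg_coefs (sqrt_poly n.+1 - sqrt_poly n).
Proof.
elim: n => [|n IH]; first by rewrite subr0; exact: sqrt_poly_ge0.
have -> : sqrt_poly n.+2 - sqrt_poly n.+1 =
  2^-1 *: ((sqrt_poly n.+1 - sqrt_poly n) * (sqrt_poly n.+1 + sqrt_poly n)).
  rewrite [sqrt_poly n.+2]/= [in X in _ - X = _]/= -scalerBr; congr (_ *: _).
  ring.
apply: nonneg_coefsZ => //; apply: nonneg_coefsM => //.
by apply: nonneg_coefsD; exact: sqrt_poly_ge0.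
Qed.

Lemma sqrt_poly_mono m n : (m <= n)%N ->
  nonneg_coefs (sqrt_poly n - sqrt_poly m).
Proof.
move=> /subnKC <-; elim: (n - m)%N => [|k IH].
  by rewrite addn0 subrr => i; rewrite coef0.
rewrite addnS -(subrK (sqrt_poly (m + k)) (sqrt_poly (m + k).+1)) -addrA.
by apply: nonneg_coefsD => //; exact: sqrt_poly_incr.
Qed.

Lemma nonneg_coefs_horner p : nonneg_coefs p -> 0 <= p.[1].
Proof.
move=> p0; rewrite horner_coef; apply: sumr_ge0 => i _.
by rewrite expr1n mulr1.
Qed.

Lemma sqrt_poly1 n : (sqrt_poly n).[1] <= 1.
Proof.
elim: n => [|n IH] /=; first by rewrite horner0.
rewrite hornerZ hornerD hornerX hornerM.
have := nonneg_coefs_horner (sqrt_poly_ge0 n).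
move: IH; move: (sqrt_poly n).[1] => a; nra.
Qed.

Let Y n x := poly_op (sqrt_poly n) x.

(** The scalars <Y n x, x> increase and are bounded by <x, x>. Since Y n - Y m is again between 0
    and 1, |Y n x - Y m x|^2 <= <Y n x, x> - <Y m x, x>, so their convergence makes the vectors
    Cauchy. *)
Lemma sqrt_iter_cvg x : cvgn (Y^~ x).
Proof.
have diff m n : (m <= n)%N -> Y n x - Y m x = poly_op (sqrt_poly n - sqrt_poly m) x.
  by rewrite poly_opD -[- sqrt_poly m]scaleN1r poly_opZ scaleN1r.
have c m n : (m <= n)%N -> (sqrt_poly n - sqrt_poly m).[1] <= 1.
  move=> mn; rewrite hornerD hornerN.
  have := nonneg_coefs_horner (sqrt_poly_ge0 m); have := sqrt_poly1 n; lra.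
have mono : {homo (fun n => '[Y n x, x]) : m n / (m <= n)%N >-> m <= n}.
  move=> m n mn; rewrite -subr_ge0 -dotBl diff//.
  by have /andP[] := poly_op_ge0_le x (sqrt_poly_mono mn) (c _ _ mn).
have cv : cvgn (fun n => '[Y n x, x]).
  apply: nondecreasing_is_cvgn => //; exists '[x, x] => _ [n _ <-].
  by have /andP[] := poly_op_ge0_le x (sqrt_poly_ge0 n) (sqrt_poly1 n).
apply: (@cauchy_dot _ _ _ hdot _
    (fun n => limn (fun n => '[Y n x, x]) - '[Y n x, x])); last first.
  by rewrite -(subrr (limn (fun n => '[Y n x, x]))); apply: cvgB => //; exact: cvg_cst.
move=> m n mn; rewrite diff//.
apply: le_trans (nonneg_contraction (@poly_op_lin _) (@poly_op_sym _) _ x) _.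
  by move=> y; apply: poly_op_ge0_le; [exact: sqrt_poly_mono|exact: c].
rewrite -diff// dotBl lerB//.
exact: (nondecreasing_cvgn_le mono cv n).
Qed.

Lemma contraction_sqrt : exists S : H -> H, [/\ linear S,
  selfadjoint dot S, forall x, 0 <= '[S x, x] <= '[x, x] &
  forall x, S (S x) = x - B x].
Proof.
pose Z x := limn (Y^~ x).
have YZ x : Y^~ x @ \oo --> Z x by exact: sqrt_iter_cvg.
have linZ' : linear Z.
  move=> a x y.
  have : (fun n => a *: Y n x + Y n y) @ \oo --> a *: Z x + Z y.
    by apply: cvgD => //; apply: cvgZl_tmp.
  under eq_fun do rewrite -(poly_op_lin (sqrt_poly _)).
  exact: (cvg_unique _ (YZ _)).
have symZ : selfadjoint dot Z.
  move=> x y.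
  have h1 : '[Y k x, y] @[k --> \oo] --> '[Z x, y] by exact: cvg_dotl.
  have h2 : '[x, Y k y] @[k --> \oo] --> '[x, Z y] by exact: cvg_dotr.
  rewrite (_ : (fun k => '[Y k x, y]) = (fun k => '[x, Y k y])) in h1.
    exact: (cvg_unique _ h1).
  by apply/funext => k; rewrite /Y poly_op_sym.
have Z01 x : 0 <= '[Z x, x] <= '[x, x].
  have h1 : '[Y k x, x] @[k --> \oo] --> '[Z x, x] by exact: cvg_dotl.
  have h2 n := poly_op_ge0_le x (sqrt_poly_ge0 n) (sqrt_poly1 n).
  apply/andP; split.
    by apply: (cvgr_to_ge h1); near=> k; have /andP[] := h2 k.
  by apply: (cvgr_to_le h1); near=> k; have /andP[] := h2 k.
(* The recursion is passed to the limit weakly: <Y k (Y k x), z> = <Y k x, Y k z>, where pointwise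
   convergence suffices. *)
have ZZ x : Z x = 2^-1 *: (B x + Z (Z x)).
  apply: (@dot_inj _ _ dot) => z.
  have h1 : '[Y k x, z] @[k --> \oo] --> '[Z x, z] by exact: cvg_dotl.
  have h2 : '[Y k.+1 x, z] @[k --> \oo] --> '[Z x, z].
    by rewrite (cvg_shiftS (fun k => '[Y k x, z])).
  rewrite (_ : (fun k => '[Y k.+1 x, z]) =
      (fun k => 2^-1 * ('[B x, z] + '[Y k x, Y k z]))) in h2.
    apply: (cvg_unique _ h2) => //; rewrite dotZl dotDl.
    apply: cvgMl_tmp; apply: cvgD; first exact: cvg_cst.
    by rewrite symZ; exact: cvg_dot.
  apply/funext => k; rewrite /Y /= poly_opZ dotZl poly_opD dotDl poly_opM.
  by rewrite poly_opX (poly_op_sym _ _ z).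
exists (fun x => x - Z x); split.
- by move=> a x y; rewrite linZ' scalerBr opprD addrACA.
- by move=> x y; rewrite dotBl dotBr symZ.
- by move=> x; rewrite dotBl; have := Z01 x; lra.
- move=> x; rewrite (linB linZ').
  have := ZZ x => /(congr1 (fun y => 2 *: y)).
  rewrite scalerA mulfV ?scale1r// => h.
  have -> : Z (Z x) = 2 *: Z x - B x by rewrite h addrAC subrr add0r.
  rewrite scaler_nat mulr2n -[Z x + Z x - _]addrA.
  have -> : Z x - (Z x + (Z x - B x)) = B x - Z x.
    by rewrite opprD addrA subrr sub0r opprB.
  by rewrite opprB addrA subrK.
Unshelve. all: by end_near. Qed.

End contraction.

(** Rescaling: C = M' (1 - B) with B = 1 - C / M' between 0 and 1. The bound M is not known to be
    positive, hence M' = |M| + 1. *)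
Lemma sqrt_exists (C : H -> H) : bounded_operator C -> selfadjoint dot C ->
  nonnegative dot C -> exists S : H -> H, [/\ bounded_operator S,
    selfadjoint dot S, nonnegative dot S & S \o S = C].
Proof.
move=> [linC [M CM]] symC C0.
pose M' := `|M| + 1; have M'0 : 0 < M' by rewrite ltr_wpDl.
have C0' x : 0 <= '[C x, x].
  by have [->|/C0//] := eqVneq x 0; rewrite dot0r.
have CM' x : '[C x, x] <= M' * '[x, x].
  apply: le_trans (ler_norm _) (le_trans (norm_dot_le hdot _ _) _).
  rewrite -(norm_dotE hdot) expr2 mulrA ler_wpM2r//.
  apply: le_trans (CM x) _; rewrite ler_wpM2r//.
  by apply: le_trans (ler_norm M) _; rewrite lerDl.
have B_lin : linear (fun x => x - M'^-1 *: C x).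
  move=> a x y; rewrite linC scalerBr !scalerDr !scalerA (mulrC a) opprD.
  by rewrite addrACA.
have symB : selfadjoint dot (fun x => x - M'^-1 *: C x).
  by move=> x y; rewrite !(dotBl, dotBr) dotZl dotZr symC.
have B01 x : 0 <= '[x - M'^-1 *: C x, x] <= '[x, x].
  rewrite dotBl dotZl; apply/andP; split.
    by rewrite subr_ge0 mulrC ler_pdivrMr// mulrC.
  by rewrite gerBl mulr_ge0// invr_ge0 ltW.
have [S [linS symS S01 SS]] := contraction_sqrt B_lin symB B01.
have sM : 0 <= Num.sqrt M' by exact: sqrtr_ge0.
exists (fun x => Num.sqrt M' *: S x); split.
- split; first by move=> a x y; rewrite linS scalerDr !scalerA mulrC.
  exists (Num.sqrt M') => x; rewrite normrZ ger0_norm// ler_wpM2l//.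
  rewrite (ler_norm_dot hdot)// (norm_dotE hdot).
  apply: le_trans (nonneg_contraction linS symS S01 x) _.
  by have /andP[] := S01 x.
- by move=> x y; rewrite dotZl dotZr symS.
- by move=> x _; rewrite dotZl mulr_ge0//; have /andP[] := S01 x.
- apply/funext => x /=; rewrite (linZ linS) scalerA -expr2 sqr_sqrtr ?(ltW M'0)//.
  by rewrite SS opprB addrC subrK scalerA mulfV ?scale1r// gt_eqF.
Qed.

Lemma sqrt_opP (C : H -> H) : bounded_operator C -> selfadjoint dot C ->
  nonnegative dot C -> [/\ bounded_operator (sqrt_op dot C),
    selfadjoint dot (sqrt_op dot C), nonnegative dot (sqrt_op dot C) &
    sqrt_op dot C \o sqrt_op dot C = C].
Proof.
move=> bC sC nC; rewrite /sqrt_op; case: xgetP => [//|h].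
by have [S /h] := sqrt_exists bC sC nC.
Qed.

(** For an operator not yet known to have a square root: the default of [sqrt_op] is the zero map,
    so one nonzero value certifies a genuine root. *)
Lemma sqrt_op_range (C : H -> H) (x : H) : x != 0 -> range (sqrt_op dot C) x ->
  [/\ bounded_operator (sqrt_op dot C),
    selfadjoint dot (sqrt_op dot C), nonnegative dot (sqrt_op dot C) &
    sqrt_op dot C \o sqrt_op dot C = C].
Proof.
move=> x0; rewrite /sqrt_op; case: xgetP => [//|_ [y _ yx]].
by rewrite -yx eqxx in x0.
Qed.

(** Douglas' range inclusion. The functional y |-> <x, Q y> is bounded by |S y| up to a constant,
    and [riesz] relative to S represents it by the preimage u. *)
Lemma douglas (S Q : H -> H) (M : R) : linear S -> linear Q ->
  selfadjoint dot S -> selfadjoint dot Q -> 0 <= M ->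
  (forall y, `|Q y| <= M * `|S y|) ->
  forall x, exists2 u, `|u| <= M * `|x| & S u = Q x.
Proof.
move=> linS linQ symS symQ M0 QS x.
have lphi : linear_for *%R (fun y => '[x, Q y]).
  by move=> a y z; rewrite linQ dotDr dotZr.
have [|y|u uM uE] := riesz hdot linS lphi (M := M * `|x|).
- by rewrite mulr_ge0.
- apply: le_trans (norm_dot_le hdot _ _) _.
  by rewrite mulrAC mulrC ler_wpM2r// QS.
exists u => //; apply: (@dot_inj _ _ dot) => z.
by rewrite symS symQ -uE.
Qed.

Lemma adjointP (A : H -> H) : bounded_operator A ->
  forall x y, '[A x, y] = '[x, adjoint dot dot A y].
Proof.
move=> [linA [M AM]] x y.
have lphi : linear_for *%R (fun z => '[A z, y]).
  by move=> a u v; rewrite linA dotDl dotZl.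
have lid : linear (@idfun H) by [].
have [|z|u _ uE] := riesz hdot lid lphi (M := `|M| * `|y|).
- by rewrite mulr_ge0.
- apply: le_trans (norm_dot_le hdot _ _) _.
  rewrite mulrAC ler_wpM2r//; apply: le_trans (AM z) _.
  by rewrite ler_wpM2r// ler_norm.
rewrite (@adjoint_eq _ _ _ A dot dot y u) => [|z]; rewrite uE dotC//.
Qed.

End square_root.

(** * Hilbert bases and spectral sums *)

(** The number of basis indices below k. Sums filtered by [below] become plain sums of this length,
    to which the lemmas on finite orthonormal families apply. *)
Definition dim_min (d : option nat) (k : nat) : nat :=
  if d is Some N then minn k N else k.

Lemma dim_minP d k i : (i < dim_min d k)%N = (i < k)%N && below d i.
Proof. by case: d => [N|] /=; rewrite ?leq_min ?andbT. Qed.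

Lemma sum_below (V : nmodType) d k (F : nat -> V) :
  \sum_(i < k | below d i) F i = \sum_(i < dim_min d k) F i.
Proof.
have dk : (dim_min d k <= k)%N by case: d => [N|] //=; rewrite geq_minl.
rewrite (big_ord_widen _ F dk); apply: eq_bigl => i.
by rewrite dim_minP ltn_ord.
Qed.

Lemma dim_min_id d p k : (forall i, (i < p)%N -> below d i) -> (p <= k)%N ->
  (p <= dim_min d k)%N.
Proof.
case: p => // p pd pk; rewrite dim_minP pk; exact: pd.
Qed.

Lemma below_ltn d i p : below d i -> ~~ below d p -> (i < p)%N.
Proof. by case: d => //= N iN; rewrite -leqNgt; exact: leq_trans. Qed.

Section hilbert_bases.
Context (R : realType) (H : completeNormedModType R) (dot : {dot H for idfun}).
Hypothesis hdot : hilbert dot.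
Local Notation "''[' x , y ]" := (dot x y).
Implicit Types x y z : H.

Lemma dense_normP (S : set H) :
  dense S <-> forall x (e : R), 0 < e -> exists2 z, S z & `|x - z| < e.
Proof.
split=> [dS x e e0|h O [x Ox] oO].
  have [||z [xz Sz]] := dS (ball x e).
  - by exists x; exact: ballxx.
  - exact: ball_open.
  - by exists z => //; rewrite -ball_normE in xz.
have /nbhs_ballP[e /= e0 xe] : nbhs x O by exact: open_nbhs_nbhs.
have [z Sz xz] := h x e e0.
by exists z; split => //; apply: xe; rewrite -ball_normE.
Qed.

Section basis.
Variables (d : option nat) (e : nat -> H).
Hypothesis eb : orthonormal_basis dot d e.

Lemma basis_upto k : orthonormal_upto dot (dim_min d k) e.
Proof.
move=> i j; rewrite !dim_minP => /andP[_ ie] /andP[_ je].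
by case: eb => + _; exact.
Qed.

Lemma basis_expansion x :
  (fun k => \sum_(i < dim_min d k) '[x, e i] *: e i) @ \oo --> x.
Proof.
have [_ /dense_normP de] := eb.
apply/cvgrPdist_lt => eps eps0; have [_ [k0 [c ->]] xc] := de x eps eps0.
near=> k; apply: le_lt_trans xc.
have k0k : (k0 <= k)%N by near: k; exact: nbhs_infty_ge.
rewrite (ler_norm_dot hdot)// (norm_dotE hdot) (sum_below _ _ (fun i => c i *: e i)).
(* Padding with zeros gives both combinations the same length, so that [pythagoras] compares them:
   the Fourier coefficients give the best approximation. *)
have -> : \sum_(i < dim_min d k0) c i *: e i =
    \sum_(i < dim_min d k) (if (i < dim_min d k0)%N then c i else 0) *: e i.
  have kk : (dim_min d k0 <= dim_min d k)%N.
    by case: d => [N|] //=; rewrite leq_min geq_minr geq_min k0k.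
  rewrite (big_ord_widen _ (fun i => c i *: e i) kk) big_mkcond.
  by apply: eq_bigr => i _; case: ifP => //; rewrite scale0r.
rewrite (pythagoras (@basis_upto k) (fun i => '[x, e i])).
rewrite (pythagoras (@basis_upto k)
  (fun i => if (i < dim_min d k0)%N then c i else 0)).
rewrite lerD2l big1 => [|i _]; last by rewrite subrr expr0n.
by apply: sumr_ge0 => i _; exact: sqr_ge0.
Unshelve. all: by end_near. Qed.

Lemma parseval x y :
  (fun k => \sum_(i < dim_min d k) '[x, e i] * '[y, e i]) @ \oo --> '[x, y].
Proof.
rewrite (_ : (fun k => _) =
    (fun k => '[\sum_(i < dim_min d k) '[x, e i] *: e i, y])).
  by apply: (cvg_dotl hdot); exact: basis_expansion.
apply/funext => k; rewrite dot_suml; apply: eq_bigr => i _.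
by rewrite dotZl (dotC _ y).
Qed.

Lemma parseval_sq x :
  (fun k => \sum_(i < dim_min d k) '[x, e i] ^+ 2) @ \oo --> '[x, x].
Proof.
by under eq_fun do under eq_bigr do rewrite expr2; exact: parseval.
Qed.

End basis.

(** The reflection in the hyperplane orthogonal to z = a - b; |a| = |b| means <z, z> = 2 <a, z>,
    whence a goes to b. By the last clause, vectors with equal products with a and b stay fixed. *)
Lemma reflection (a b : H) : '[a, a] = '[b, b] ->
  exists rho : H -> H, [/\ linear rho, forall x y, '[rho x, rho y] = '[x, y],
    involutive rho, rho a = b & forall x, exists2 t,
      rho x = x + t *: (a - b) & ('[x, a] = '[x, b] -> t = 0)].
Proof.
move=> ab; have [<-|neq] := eqVneq a b.
  exists idfun; split => // x; exists 0 => //.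
  by rewrite scale0r addr0.
have [z zE] : exists z, z = a - b by exists (a - b).
have z0 : 0 < '[z, z] by apply: dot_gt0; rewrite zE subr_eq0.
pose rho x := x - (2 * '[x, z] / '[z, z]) *: z.
have E : '[z, z] = 2 * '[a, z].
  by rewrite zE !(dotDl, dotDr, dotNl, dotNr) -ab (dotC _ b a); ring.
exists rho; split.
- move=> c x y; rewrite /rho dotDl dotZl scalerBr scalerA.
  rewrite -[2 * (c * _ + _) / _]/(2 * (c * _ + _) * _) mulrDr mulrDl scalerDl.
  by rewrite opprD addrACA; congr (_ - _ *: _ + _); ring.
- move=> x y; rewrite /rho !(dotDl, dotDr, dotNl, dotNr, dotZl, dotZr) (dotC _ z y).
  by field; rewrite gt_eqF.
- move=> x; rewrite {1}/rho {2}/rho dotBl dotZl divfK ?gt_eqF//.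
  rewrite /rho -addrA -opprD -scalerDl.
  by rewrite -[RHS]subr0 -(scale0r z); congr (_ - _ *: _); ring.
- by rewrite /rho -E divff ?gt_eqF// scale1r zE opprB addrC subrK.
- move=> x; exists (- (2 * '[x, z] / '[z, z])); first by rewrite scaleNr -zE.
  by move=> xz; rewrite {1}zE dotBr xz subrr mulr0 mul0r oppr0.
Qed.

Lemma basis_swap d e (a b : H) : orthonormal_basis dot d e ->
  '[a, a] = '[b, b] ->
  exists rho : H -> H, [/\ orthonormal_basis dot d (rho \o e), rho a = b &
    forall x, '[x, a] = '[x, b] -> rho x = x].
Proof.
move=> eb /reflection[rho [lin iso inv rab rE]].
exists rho; split => // [|x xz]; last first.
  by have [t -> /(_ xz) ->] := rE x; rewrite scale0r addr0.
split=> [i j di dj /=|]; first by rewrite iso; exact: eb.1.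
apply/dense_normP => x eps eps0.
have [_ /dense_normP/(_ (rho x) eps eps0)[_ [k [c ->]] h]] := eb.
exists (rho (\sum_(i < k | below d i) c i *: e i)).
  by exists k, c; rewrite (lin_sum lin); apply: eq_bigr => i _; rewrite (linZ lin).
by rewrite -[x in `|x - _|]inv -(linB lin) hdot iso -hdot.
Qed.

(* Reflections send the basis vectors to the u i one at a time, which keeps the
   index set of the basis. *)
Lemma basis_extend d w p u : orthonormal_basis dot d w ->
  orthonormal_upto dot p u ->
  exists e, [/\ orthonormal_basis dot d e, forall i, (i < p)%N -> e i = u i &
    forall i, (i < p)%N -> below d i].
Proof.
move=> wb; elim: p => [|p IH] up; first by exists w.
have [i j ip jp|e [eb eu pd]] := IH; first by apply: up; exact: ltnW.
(* If the basis had at most p vectors, they would all be among the u i with i < p, and Parseval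
   would give |u p| = 0. *)
have dp : below d p.
  apply: contraT => ndp; have := @parseval_sq _ _ eb (u p).
  rewrite (_ : (fun k => _) = cst 0) => [h|].
    have : '[u p, u p] = 0 by apply: (cvg_unique _ h (cvg_cst _)).
    by rewrite up// eqxx => /eqP; rewrite oner_eq0.
  apply/funext => k; apply: big1 => i _; have := ltn_ord i.
  rewrite dim_minP => /andP[_ di]; have ip := below_ltn di ndp.
  by rewrite eu// up ?ltnS ?(ltnW ip)// gtn_eqF// expr0n.
have pd' i : (i < p.+1)%N -> below d i.
  by rewrite ltnS leq_eqVlt => /orP[/eqP->|/pd].
have [|rho [rb rp rx]] := basis_swap (a := e p) (b := u p) eb.
  by rewrite up// eb.1.
exists (rho \o e); split => // i; rewrite ltnS leq_eqVlt => /orP[/eqP->//|ip] /=.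
(* The vectors already placed are orthogonal to both e p and u p, hence fixed by the reflection. *)
rewrite rx; first exact: eu.
by rewrite eb.1 ?pd' ?ltnS ?(ltnW ip)// eu// up ?ltnS ?(ltnW ip).
Qed.

(** [spectral_sum] chooses an eigenbasis, so its value must be shown independent of the choice. For
    any eigenbasis e, f (Lambda j) = sum_k f (mu k) <e j, u k>^2, and summing over j gives 1 for
    each k by Parseval. An eigenbasis exists by completing u. *)
Lemma spectral_sumE d w p u (mu : nat -> R) (f : R -> R) (T : H -> H) :
  orthonormal_basis dot d w -> orthonormal_upto dot p u -> f 0 = 0 ->
  (forall x, T x = \sum_(k < p) (mu k * '[x, u k]) *: u k) ->
  spectral_sum dot f T = \sum_(k < p) f (mu k).
Proof.
move=> wb up f0 TE.
have key d' Lambda e : orthonormal_basis dot d' e ->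
    (forall i, below d' i -> T (e i) = Lambda i *: e i) ->
    (fun k => \sum_(i < k | below d' i) f (Lambda i)) @ \oo -->
      \sum_(k < p) f (mu k).
  move=> eb eT.
  (* Where <e j, u k> is nonzero, mu k = Lambda j. If Lambda j is nonzero, e j lies in the span of u
     and the weights add up to 1; if it is 0, both sides vanish because f 0 = 0. *)
  have fE j : below d' j ->
      f (Lambda j) = \sum_(k < p) f (mu k) * '[e j, u k] ^+ 2.
    move=> dj; have me k : (k < p)%N -> mu k * '[e j, u k] = Lambda j * '[e j, u k].
      move=> kp; rewrite -[RHS]dotZl -eT// TE.
      by rewrite (orthonormal_sum up (fun k => mu k * '[e j, u k])).
    rewrite (eq_bigr (fun k : 'I_p => f (Lambda j) * '[e j, u k] ^+ 2)); last first.
      move=> k _; have := me k (ltn_ord k).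
      have [->|ek] := eqVneq '[e j, u k] 0; first by rewrite expr0n !mulr0.
      by move=> /(mulIf ek) ->.
    rewrite -mulr_sumr; have [->|L0] := eqVneq (Lambda j) 0.
      by rewrite f0 mul0r.
    suff -> : \sum_(k < p) '[e j, u k] ^+ 2 = 1 by rewrite mulr1.
    have ejE : e j = \sum_(k < p) '[e j, u k] *: u k.
      apply: (scalerI L0); rewrite -eT// TE scaler_sumr; apply: eq_bigr => k _.
      by rewrite me// scalerA.
    transitivity '[e j, e j]; last by rewrite eb.1// eqxx.
    rewrite [in RHS]ejE dot_suml; apply: eq_bigr => k _.
    by rewrite dotZl -[in RHS]ejE expr2 (dotC _ (u k)).
  rewrite (_ : (fun k => _) = (fun n => \sum_(k < p) f (mu k) *
      \sum_(i < dim_min d' n) '[u k, e i] ^+ 2)); last first.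
    apply/funext => n; rewrite (sum_below _ _ (f \o Lambda)).
    under [RHS]eq_bigr do rewrite mulr_sumr.
    rewrite exchange_big; apply: eq_bigr => i _ /=; rewrite fE.
      by apply: eq_bigr => k _; rewrite (dotC _ (u k)).
    by have := ltn_ord i; rewrite dim_minP => /andP[].
  apply: cvg_big => [|k _]; first exact: add_continuous.
  rewrite -[X in _ --> X]mulr1; apply: cvgMl_tmp.
  have := @parseval_sq _ _ eb (u k); by rewrite up// eqxx.
rewrite /spectral_sum; case: xgetP => [s _ [d' [L [e [eb eT es]]]]|].
  exact: cvg_unique es (key d' L e eb eT).
have [e [eb eu pd]] := basis_extend wb up.
move=> /(_ (\sum_(k < p) f (mu k))); case.
pose L i := if (i < p)%N then mu i else 0.
have eT i : below d i -> T (e i) = L i *: e i.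
  move=> di; rewrite TE /L; case: ltnP => ip.
    rewrite (bigD1 (Ordinal ip))//= -eu// eb.1// eqxx mulr1 big1 ?addr0// => j ji.
    rewrite -eu// eb.1 ?pd// (_ : (i == j :> nat) = false) ?mulr0 ?scale0r//.
    by apply/negbTE; rewrite eq_sym.
  rewrite scale0r big1// => j _; rewrite -eu// eb.1 ?di ?pd//.
  by rewrite gtn_eqF ?mulr0 ?scale0r// (leq_trans (ltn_ord j)).
by rewrite /=; exists d, L, e; split => //; exact: (key d L e eb eT).
Qed.

End hilbert_bases.

(** * Symmetric operators of finite rank *)

(* The real and imaginary parts x and y of a complex eigenvector for the
   eigenvalue a satisfy Im a (|x|^2 + |y|^2) = 0. *)
Lemma symmetric_eigenvector (R : realType) (p : nat) (B : 'M[R]_p.+1) :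
  B^T = B -> exists (v : 'rV[R]_p.+1) mu, v != 0 /\ v *m B = mu *: v.
Proof.
move=> Bsym; pose Bc : 'M[R[i]]_p.+1 := map_mx (real_complex R) B.
have [a ea] : exists a, eigenvalue (n := p.+1) Bc a.
  have [|a ra] := closed_rootP (char_poly Bc) _.
    by rewrite size_char_poly.
  by exists a; rewrite eigenvalue_root_char.
have /eigenvalueP[v vB v0] := ea.
pose x := map_mx (@complex.Re R) v; pose y := map_mx (@complex.Im R) v.
have Re_sum (F : 'I_p.+1 -> R[i]) :
    complex.Re (\sum_j F j) = \sum_j complex.Re (F j).
  by apply: (big_morph (@complex.Re R)) => // -[? ?] [].
have Im_sum (F : 'I_p.+1 -> R[i]) :
    complex.Im (\sum_j F j) = \sum_j complex.Im (F j).
  by apply: (big_morph (@complex.Im R)) => // -[? ?] [].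
have xB : x *m B = complex.Re a *: x - complex.Im a *: y.
  apply/rowP => j; have /rowP/(_ j)/(congr1 (@complex.Re R)) := vB.
  rewrite !mxE Re_sum; case: (a) => a1 a2; case: (v 0 j) => v1 v2 /= <-.
  apply: eq_bigr => i _; rewrite !mxE; case: (v 0 i) => w1 w2 /=.
  by rewrite mulr0 subr0.
have yB : y *m B = complex.Re a *: y + complex.Im a *: x.
  apply/rowP => j; have /rowP/(_ j)/(congr1 (@complex.Im R)) := vB.
  rewrite !mxE Im_sum; case: (a) => a1 a2; case: (v 0 j) => v1 v2 /= <-.
  apply: eq_bigr => i _; rewrite !mxE; case: (v 0 i) => w1 w2 /=.
  by rewrite mulr0 add0r.
have sq (z : 'rV[R]_p.+1) : (z *m z^T) 0 0 = \sum_j z 0 j ^+ 2.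
  by rewrite mxE; apply: eq_bigr => j _; rewrite mxE expr2.
have sq0 (z : 'rV[R]_p.+1) : (z *m z^T) 0 0 = 0 -> z = 0.
  rewrite sq => /eqP; rewrite psumr_eq0 => [/allP z0|j _]; last exact: sqr_ge0.
  apply/rowP => j; rewrite mxE; apply/eqP; rewrite -sqrf_eq0.
  exact: z0 (mem_index_enum j).
have sq_ge0 (z : 'rV[R]_p.+1) : 0 <= (z *m z^T) 0 0.
  by rewrite sq sumr_ge0// => j _; exact: sqr_ge0.
have ima : complex.Im a = 0.
  have E : (x *m B *m y^T) 0 0 = (y *m B *m x^T) 0 0.
    by rewrite -[in RHS](trmxK (y *m B *m x^T)) [RHS]mxE !trmx_mul trmxK Bsym mulmxA.
  move: E; rewrite xB yB !mulmxDl !mulNmx -!scalemxAl.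
  have -> : y *m x^T = (x *m y^T)^T by rewrite trmx_mul trmxK.
  rewrite !mxE => E.
  have : complex.Im a * ((x *m x^T) 0 0 + (y *m y^T) 0 0) = 0.
    by rewrite !mxE; lra.
  move=> /eqP; rewrite mulf_eq0 => /orP[/eqP//|].
  rewrite paddr_eq0// => /andP[/eqP/sq0 x0 /eqP/sq0 y0].
  suff : v = 0 by move=> h; rewrite h eqxx in v0.
  apply/rowP => j; have /rowP/(_ j) := x0; have /rowP/(_ j) := y0.
  by rewrite !mxE; case: (v 0 j) => c1 c2 /= -> ->.
have [x0|x0] := eqVneq x 0; last first.
  by exists x, (complex.Re a); split => //; rewrite xB ima scale0r subr0.
exists y, (complex.Re a); split; last by rewrite yB ima scale0r addr0.
apply: contraNneq v0 => y0.
apply/eqP/rowP => j; have /rowP/(_ j) := x0; have /rowP/(_ j) := y0.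
by rewrite !mxE; case: (v 0 j) => c1 c2 /= -> ->.
Qed.

(** * Spans, Gram-Schmidt and diagonalization in finite rank *)

Section spans.
Context (R : realType) (H : completeNormedModType R) (dot : {dot H for idfun}).
Local Notation "''[' x , y ]" := (dot x y).
Implicit Types x y z : H.

Definition in_span (p : nat) (u : nat -> H) x :=
  exists c : nat -> R, x = \sum_(k < p) c k *: u k.

Lemma in_span_lin p u a x y :
  in_span p u x -> in_span p u y -> in_span p u (a *: x + y).
Proof.
move=> [c ->] [b ->]; exists (fun k => a * c k + b k).
rewrite scaler_sumr -big_split; apply: eq_bigr => k _ /=.
by rewrite scalerA scalerDl.
Qed.

Lemma in_span0 p u : in_span p u 0.
Proof. by exists (fun=> 0); rewrite big1// => k _; rewrite scale0r. Qed.

Lemma in_spanZ p u a x : in_span p u x -> in_span p u (a *: x).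
Proof. by move=> ux; rewrite -[_ *: _]addr0; apply: in_span_lin => //; exact: in_span0. Qed.

Lemma in_spanD p u x y :
  in_span p u x -> in_span p u y -> in_span p u (x + y).
Proof. by move=> ux uy; rewrite -[x]scale1r; exact: in_span_lin. Qed.

Lemma in_span_mem p u k : (k < p)%N -> in_span p u (u k).
Proof.
move=> kp; exists (fun i => (i == k)%:R).
rewrite (bigD1 (Ordinal kp))//= eqxx scale1r big1 ?addr0// => i ik.
by rewrite (_ : (i == k :> nat) = false) ?scale0r//; exact/negbTE.
Qed.

Lemma in_span_sum p u n (c : nat -> R) (F : nat -> H) :
  (forall i, (i < n)%N -> in_span p u (F i)) ->
  in_span p u (\sum_(i < n) c i *: F i).
Proof.
elim: n => [|n IH] uF; first by rewrite big_ord0; exact: in_span0.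
rewrite big_ord_recr; apply: in_spanD; last exact/in_spanZ/uF.
by apply: IH => i ni; apply: uF; exact: ltnW.
Qed.

Lemma in_span_trans p u q v x :
  (forall k, (k < p)%N -> in_span q v (u k)) -> in_span p u x -> in_span q v x.
Proof. by move=> uv [c ->]; exact: in_span_sum. Qed.

Lemma in_spanS p u x : in_span p u x -> in_span p.+1 u x.
Proof.
by apply: in_span_trans => k kp; apply: in_span_mem; exact: ltnW.
Qed.

Lemma in_spanE p u x : orthonormal_upto dot p u -> in_span p u x ->
  x = \sum_(k < p) '[x, u k] *: u k.
Proof. by move=> up [c]; exact: span_bessel. Qed.

Lemma in_span_orth p u x z : (forall k, (k < p)%N -> '[u k, z] = 0) ->
  in_span p u x -> '[x, z] = 0.
Proof.
by move=> uz [c ->]; rewrite dot_suml big1// => k _; rewrite dotZl uz// mulr0.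
Qed.

Lemma eq_in_span p u u' x : (forall k, (k < p)%N -> u k = u' k) ->
  in_span p u x -> in_span p u' x.
Proof. by move=> uu [c ->]; exists c; apply: eq_bigr => k _; rewrite uu. Qed.

Lemma orthonormal_rcons p u a : orthonormal_upto dot p u ->
  (forall i, (i < p)%N -> '[u i, a] = 0) -> '[a, a] = 1 ->
  orthonormal_upto dot p.+1 (fun i => if i == p then a else u i).
Proof.
move=> up ua aa i j; rewrite !ltnS => ip jp.
have [ei|ip'] := eqVneq i p; have [ej|jp'] := eqVneq j p.
- by rewrite ei ej aa eqxx.
- by rewrite dotC ua ?ltn_neqAle ?jp'// ei eq_sym (negbTE jp').
- by rewrite ua ?ltn_neqAle ?ip'// ej (negbTE ip').
- by rewrite up// ltn_neqAle ?ip' ?jp'.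
Qed.

Lemma normalize x : x != 0 -> exists2 a : R, a != 0 & '[a *: x, a *: x] = 1.
Proof.
move=> x0; have xx := dot_gt0 dot x0; exists (Num.sqrt '[x, x])^-1.
  by rewrite invr_neq0// gt_eqF// sqrtr_gt0.
rewrite dotZl dotZr mulrA -expr2 exprVn sqr_sqrtr ?(ltW xx)// mulVf//.
by rewrite gt_eqF.
Qed.

(* Equality case of the Hilbert-Schmidt norm bound
   sum_k <T z_k, z_k>^2 <= sum_k |T z_k|^2 <= |T|_HS^2. *)
Lemma hilbert_schmidt_rigidity q e (mu : nat -> R) n (z : nat -> H) (T : H -> H) :
  orthonormal_upto dot q e -> orthonormal_upto dot n z ->
  (forall x, T x = \sum_(j < q) (mu j * '[x, e j]) *: e j) ->
  \sum_(j < q) mu j ^+ 2 <= \sum_(k < n) '[T (z k), z k] ^+ 2 ->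
  (forall x, T x = \sum_(k < n) ('[T (z k), z k] * '[x, z k]) *: z k) /\
  \sum_(j < q) mu j ^+ 2 = \sum_(k < n) '[T (z k), z k] ^+ 2.
Proof.
move=> eo zo TE le.
have Tdot x y : '[T x, y] = \sum_(j < q) mu j * '[x, e j] * '[y, e j].
  rewrite TE dot_suml; apply: eq_bigr => j _.
  by rewrite dotZl (dotC _ y).
have symT x y : '[T x, y] = '[x, T y].
  rewrite [RHS]dotC !Tdot; apply: eq_bigr => j _; ring.
have TT x : '[T x, T x] = \sum_(j < q) mu j ^+ 2 * '[x, e j] ^+ 2.
  rewrite Tdot; apply: eq_bigr => j _.
  rewrite TE (orthonormal_sum eo (fun j => mu j * '[x, e j]))//; ring.
(* The deficits in Cauchy-Schwarz at z k ([D1]) and in Bessel at e j ([D2]). They are nonnegative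
   and add up to a quantity that is at most 0, so each one vanishes. *)
pose D1 k := '[T (z k), T (z k)] - '[T (z k), z k] ^+ 2.
pose D2 j := mu j ^+ 2 * (1 - \sum_(k < n) '[e j, z k] ^+ 2).
have D1_ge0 (k : 'I_n) : 0 <= D1 k.
  rewrite subr_ge0; apply: le_trans (cauchy_schwarz _ _ _) _.
  by rewrite zo// eqxx mulr1.
have D2_ge0 (j : 'I_q) : 0 <= D2 j.
  rewrite mulr_ge0 ?sqr_ge0// subr_ge0.
  by apply: le_trans (bessel zo (e j)) _; rewrite eo// eqxx.
have D12 : \sum_(k < n) D1 k + \sum_(j < q) D2 j =
    \sum_(j < q) mu j ^+ 2 - \sum_(k < n) '[T (z k), z k] ^+ 2.
  rewrite /D1 /D2 sumrB; under [X in _ + X]eq_bigr do rewrite mulrBr mulr1.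
  rewrite sumrB; under eq_bigr do rewrite TT.
  rewrite exchange_big /=.
  under [X in _ + (_ - X)]eq_bigr do rewrite mulr_sumr.
  have -> : \sum_(j < q) \sum_(i < n) mu j ^+ 2 * '[z i, e j] ^+ 2 =
            \sum_(j < q) \sum_(i < n) mu j ^+ 2 * '[e j, z i] ^+ 2.
    by apply: eq_bigr => j _; apply: eq_bigr => i _; rewrite dotC.
  lra.
have D1s0 : 0 <= \sum_(k < n) D1 k by exact: sumr_ge0.
have D2s0 : 0 <= \sum_(j < q) D2 j by exact: sumr_ge0.
have D1E : \sum_(k < n) D1 k == 0 by apply/eqP; lra.
have D2E : \sum_(j < q) D2 j == 0 by apply/eqP; lra.
split; last by lra.
have Tz (k : 'I_n) : T (z k) = '[T (z k), z k] *: z k.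
  move: D1E; rewrite psumr_eq0// => /allP/(_ k (mem_index_enum _)) /eqP.
  rewrite /D1 => h; apply/eqP; rewrite -subr_eq0; apply/eqP/(dot_eq0 (dot := dot)).
  rewrite !(dotDl, dotDr, dotNl, dotNr, dotZl, dotZr) (dotC _ (z k) (T _)).
  by rewrite zo// eqxx mulr1; lra.
(* Vanishing of [D2] puts every e j with mu j nonzero into the span of z, which therefore contains
   the range of T. *)
move=> x; have Tx : in_span n z (T x).
  rewrite TE; elim/big_rec: _ => [|j y _ IH]; first exact: in_span0.
  apply: in_spanD => //; have [->|mu0] := eqVneq (mu j) 0.
    by rewrite mul0r scale0r; exact: in_span0.
  apply: in_spanZ; exists (fun k => '[e j, z k]); apply: bessel_eq => //.
  move: D2E; rewrite psumr_eq0// => /allP/(_ j (mem_index_enum _)) /eqP.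
  move=> /eqP; rewrite mulf_eq0 sqrf_eq0 (negbTE mu0)/= subr_eq0 => /eqP <-.
  by rewrite eo// eqxx.
rewrite {1}(in_spanE zo Tx); apply: eq_bigr => k _.
by congr (_ *: _); rewrite symT {1}Tz dotZr.
Qed.

Lemma gram_schmidt N (a : nat -> H) : exists p u, [/\ (p <= N)%N,
  orthonormal_upto dot p u, forall i, (i < N)%N -> in_span p u (a i) &
  forall j, (j < p)%N -> in_span N a (u j)].
Proof.
elim: N => [|N [p [u [pN up ua au]]]]; first by exists 0, (fun=> 0); split.
pose b := a N - \sum_(k < p) '[a N, u k] *: u k.
have aE : a N = b + \sum_(k < p) '[a N, u k] *: u k by rewrite subrK.
have sp : in_span p u (\sum_(k < p) '[a N, u k] *: u k) by exists (fun k => '[a N, u k]).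
have au' j : (j < p)%N -> in_span N.+1 a (u j) by move=> /au; exact: in_spanS.
have [b0|b0] := eqVneq b 0.
  exists p, u; split => //; first exact: leqW.
  move=> i; rewrite ltnS leq_eqVlt => /orP[/eqP->|/ua//].
  by rewrite aE b0 add0r.
have bu k : (k < p)%N -> '[u k, b] = 0.
  move=> kp; rewrite dotC dotBl (orthonormal_sum up (fun k => '[a N, u k]))//.
  by rewrite subrr.
have [t t0 tb] := normalize b0.
exists p.+1, (fun i => if i == p then t *: b else u i).
have uS x : in_span p u x ->
    in_span p.+1 (fun i => if i == p then t *: b else u i) x.
  move=> ux; apply/in_spanS; apply: eq_in_span ux => k kp.
  by rewrite ltn_eqF.
split.
- by rewrite ltnS.
- by apply: orthonormal_rcons => // i ip; rewrite dotZr bu// mulr0.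
- move=> i; rewrite ltnS leq_eqVlt => /orP[/eqP->|/ua]; last exact: uS.
  rewrite aE; apply: in_spanD; last exact: uS.
  rewrite -[b in in_span _ _ b]scale1r -(mulVf t0) -scalerA; apply: in_spanZ.
  have := @in_span_mem p.+1 (fun i => if i == p then t *: b else u i) p (leqnn _).
  by rewrite /= eqxx.
- move=> j; rewrite ltnS leq_eqVlt; have [-> _|/= _ /au'//] := eqVneq j p.
  apply: in_spanZ; rewrite /b -scaleN1r addrC; apply: in_span_lin.
    exact: in_span_trans sp.
  exact: in_span_mem.
Qed.

(* A reflection moves the last vector to a unit eigenvector; the image of the
   span of the other ones is then T-invariant. *)
Lemma diagonalize_span p u (T : H -> H) : linear T -> selfadjoint dot T ->
  orthonormal_upto dot p u -> (forall j, (j < p)%N -> in_span p u (T (u j))) ->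
  exists u' mu, [/\ orthonormal_upto dot p u',
    forall j, (j < p)%N -> in_span p u (u' j),
    forall j, (j < p)%N -> in_span p u' (u j) &
    forall j, (j < p)%N -> T (u' j) = mu j *: u' j].
Proof.
move=> linT symT; elim: p u => [|p IH] u up uT.
  by exists (fun=> 0), (fun=> 0); split.
pose B : 'M[R]_p.+1 := \matrix_(j, k) '[T (u j), u k].
have [v [m [v0 vB]]] : exists (v : 'rV[R]_p.+1) mu, v != 0 /\ v *m B = mu *: v.
  apply: symmetric_eigenvector; apply/matrixP => j k.
  by rewrite !mxE symT dotC.
pose e0 := \sum_(j < p.+1) v 0 (inord j) *: u j.
have Te0 : T e0 = m *: e0.
  rewrite (lin_sum linT) scaler_sumr.
  transitivity (\sum_(j < p.+1) \sum_(k < p.+1) (v 0 j * B j k) *: u k).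
    apply: eq_bigr => j _; rewrite (linZ linT) inord_val.
    rewrite {1}(in_spanE up (uT j (ltn_ord j))) scaler_sumr.
    by apply: eq_bigr => k _; rewrite scalerA mxE.
  rewrite exchange_big; apply: eq_bigr => k _ /=; rewrite inord_val scalerA.
  have /rowP/(_ k) := vB; rewrite !mxE => <-.
  by rewrite scaler_suml.
have e00 : e0 != 0.
  apply: contraNneq v0 => e00; apply/eqP/rowP => j; rewrite mxE.
  have := orthonormal_sum up (fun j => v 0 (inord j)) (ltn_ord j).
  by rewrite -/e0 e00 dot0l inord_val.
have [t t0 tt] := normalize e00.
pose e := t *: e0.
have Te : T e = m *: e by rewrite (linZ linT) Te0 !scalerA mulrC.
have eu : in_span p.+1 u e.
  by apply: in_spanZ; exists (fun j => v 0 (inord j)).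
have [|rho [lin iso inv re rE]] := @reflection _ _ dot (u p) e.
  by rewrite tt up// eqxx.
pose u1 := rho \o u.
have u1p : u1 p = e by [].
have u1o : orthonormal_upto dot p.+1 u1 by move=> i j ip jp; rewrite /= iso up.
have zu : in_span p.+1 u (u p - e).
  rewrite -scaleN1r addrC; apply: in_span_lin => //; exact: in_span_mem.
have zu1 : in_span p.+1 u1 (u p - e).
  have -> : u p - e = -1 *: rho (u p - e).
    by rewrite (linB lin) re -re inv scaleN1r opprB.
  apply: in_spanZ; case: zu => c ->; exists c.
  by rewrite (lin_sum lin); apply: eq_bigr => i _; rewrite (linZ lin).
have u1u j : (j < p.+1)%N -> in_span p.+1 u (u1 j).
  move=> jp; rewrite /u1 /=; have [s -> _] := rE (u j).
  by rewrite addrC; apply: in_span_lin => //; exact: in_span_mem.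
have uu1 j : (j < p.+1)%N -> in_span p.+1 u1 (u j).
  move=> jp; have [s h _] := rE (u j).
  have -> : u j = (- s) *: (u p - e) + u1 j by rewrite /u1 /= h addrC scaleNr addrK.
  by apply: in_span_lin => //; exact: in_span_mem.
have u1T j : (j < p)%N -> in_span p u1 (T (u1 j)).
  move=> jp; exists (fun k => '[T (u1 j), u1 k]).
  have h : in_span p.+1 u1 (T (u1 j)).
    apply: (in_span_trans uu1); case: (u1u j (ltnW jp)) => c ->.
    by rewrite (lin_sum linT); under eq_bigr do rewrite (linZ linT);
      apply: (@in_span_sum _ _ _ _ (T \o u)).
  rewrite {1}(in_spanE u1o h) big_ord_recr /= -/(u1 p) u1p symT Te dotZr.
  by rewrite -u1p u1o ?ltnS ?(ltnW jp)// ltn_eqF// mulr0 scale0r addr0.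
have [|//|u2 [mu [u2o u2u u22 u2T]]] := IH u1.
  by move=> i j ip jp; apply: u1o; exact: ltnW.
pose w i := if i == p then e else u2 i.
have u2w x : in_span p u2 x -> in_span p.+1 w x.
  move=> ux; apply/in_spanS; apply: eq_in_span ux => k kp.
  by rewrite /w ltn_eqF.
have u1w k : (k < p.+1)%N -> in_span p.+1 w (u1 k).
  rewrite ltnS leq_eqVlt => /orP[/eqP->|/u22/u2w//].
  have -> : u1 p = w p by rewrite /w eqxx.
  exact: in_span_mem.
exists w, (fun i => if i == p then m else mu i); split.
- apply: orthonormal_rcons => // i ip.
  apply: in_span_orth (u2u i ip) => k kp.
  by rewrite -u1p u1o ?ltnS ?(ltnW kp)// ltn_eqF.
- move=> j; rewrite ltnS leq_eqVlt /w; have [-> _ //|/= _ jp] := eqVneq j p.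
  apply: (in_span_trans u1u); apply: in_spanS; exact: u2u.
- by move=> j jp; apply: in_span_trans (uu1 j jp).
- move=> j; rewrite ltnS leq_eqVlt /w; have [_ _ //|/= _ jp] := eqVneq j p.
  exact: u2T.
Qed.

(** The range lies in the span of a, where [diagonalize_span] applies; for arbitrary x the
    coefficients follow from <T x, u' j> = <x, T (u' j)>. *)
Lemma finite_rank_diag N (a : nat -> H) (eps : nat -> R) :
  exists p u (mu : nat -> R), [/\ (p <= N)%N, orthonormal_upto dot p u,
    forall j, (j < p)%N -> in_span N a (u j) &
    forall x, \sum_(i < N) (eps i * '[x, a i]) *: a i =
              \sum_(j < p) (mu j * '[x, u j]) *: u j].
Proof.
have [p [u [pN up ua au]]] := gram_schmidt N a.
pose T x := \sum_(i < N) (eps i * '[x, a i]) *: a i.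
have linT : linear T.
  move=> c x y; rewrite /T scaler_sumr -big_split; apply: eq_bigr => i _ /=.
  by rewrite dotDl dotZl scalerA -scalerDl; congr (_ *: _); ring.
have symT : selfadjoint dot T.
  move=> x y; rewrite /T dot_suml dot_sumr; apply: eq_bigr => i _ /=.
  by rewrite dotZl dotZr (dotC _ (a i)); ring.
have uT x : in_span p u (T x).
  exact: (@in_span_sum _ _ _ (fun i => eps i * '[x, a i])).
have [u' [mu [u'o uu' u'u u'T]]] := diagonalize_span linT symT up (fun j _ => uT (u j)).
exists p, u', mu; split => // [j jp|x].
  exact: in_span_trans (uu' j jp).
rewrite -/(T x) (in_spanE u'o (in_span_trans u'u (uT x))).
by apply: eq_bigr => j _; rewrite symT u'T// dotZr.
Qed.

End spans.

(** * The operator R(C2 || C1) *)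

Section relative_operator.
Context (R : realType) (H : completeNormedModType R) (dot : {dot H for idfun}).
Hypothesis hdot : hilbert dot.
Local Notation "''[' x , y ]" := (dot x y).
Implicit Types x y z : H.

Section square_root_facts.
Variable C : H -> H.
Hypotheses (bC : bounded_operator C) (sC : selfadjoint dot C).
Hypothesis pC : positive dot C.
Local Notation S := (sqrt_op dot C).

Lemma positive_nonnegative : nonnegative dot C.
Proof. by move=> x /pC/ltW. Qed.

Lemma sqrt_lin : linear S.
Proof. by case: (sqrt_opP hdot bC sC positive_nonnegative) => -[]. Qed.

Lemma sqrt_sym x y : '[S x, y] = '[x, S y].
Proof. by case: (sqrt_opP hdot bC sC positive_nonnegative) => _ /(_ x y). Qed.

Lemma sqrt_sqr x : S (S x) = C x.
Proof.
by case: (sqrt_opP hdot bC sC positive_nonnegative) => _ _ _ /(congr1 (@^~ x)).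
Qed.

Lemma sqrt_dot x y : '[S x, S y] = '[C x, y].
Proof. by rewrite -sqrt_sym sqrt_sqr. Qed.

Lemma sqrt_inj x : S x = 0 -> x = 0.
Proof.
move=> Sx; apply/eqP/contraT => /pC.
by rewrite -sqrt_dot Sx dot0l ltxx.
Qed.

Lemma sqrt_eq x y : S x = S y -> x = y.
Proof.
move=> Sxy; apply/eqP; rewrite -subr_eq0; apply/eqP/sqrt_inj.
by rewrite (linB sqrt_lin) Sxy subrr.
Qed.

End square_root_facts.

Lemma sqrt_range_le (C1 C2 : H -> H) (K : R) :
  bounded_operator C1 -> selfadjoint dot C1 -> positive dot C1 ->
  bounded_operator C2 -> selfadjoint dot C2 -> positive dot C2 ->
  0 < K -> (forall x, '[C2 x, x] <= K * '[C1 x, x]) ->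
  forall x, exists2 u, `|u| <= Num.sqrt K * `|x| &
    sqrt_op dot C1 u = sqrt_op dot C2 x.
Proof.
move=> b1 s1 p1 b2 s2 p2 K0 le21.
have K0' := ltW K0.
apply: douglas => //.
- exact: sqrt_lin.
- exact: sqrt_lin.
- exact: sqrt_sym.
- exact: sqrt_sym.
- move=> y; rewrite (ler_norm_dot hdot) ?mulr_ge0 ?sqrtr_ge0//.
  rewrite exprMn sqr_sqrtr// (norm_dotE hdot).
  by rewrite !sqrt_dot.
Qed.

Section pair.
Variables (C1 C2 : H -> H) (K : R).
Hypotheses (b1 : bounded_operator C1) (s1 : selfadjoint dot C1).
Hypotheses (p1 : positive dot C1).
Hypotheses (b2 : bounded_operator C2) (s2 : selfadjoint dot C2).
Hypotheses (p2 : positive dot C2).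
Hypotheses (K0 : 0 < K) (le12 : forall x, '[C1 x, x] <= K * '[C2 x, x]).
Hypotheses (le21 : forall x, '[C2 x, x] <= K * '[C1 x, x]).

Local Notation S1 := (sqrt_op dot C1).
Local Notation S2 := (sqrt_op dot C2).
Let A := op_inv S1 \o S2.
Local Notation T := (relative_op dot C2 C1).
Let S1_eq := sqrt_eq b1 s1 p1.

Let SA x : S1 (A x) = S2 x.
Proof.
rewrite /A /= op_invK//.
by have [u _ uE] := sqrt_range_le b1 s1 p1 b2 s2 p2 K0 le21 x; exists u.
Qed.

Let A_bounded : bounded_operator A.
Proof.
split.
  move=> a x y; apply: S1_eq.
  by rewrite (sqrt_lin b1 s1 p1) !SA (sqrt_lin b2 s2 p2).
exists (Num.sqrt K) => x.
have [u uK uE] := sqrt_range_le b1 s1 p1 b2 s2 p2 K0 le21 x.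
by rewrite (_ : A x = u)//; apply: S1_eq; rewrite SA.
Qed.

Let adjA x y : '[A x, y] = '[x, adjoint dot dot A y].
Proof. exact: adjointP. Qed.

Let adjAS y : adjoint dot dot A (S1 y) = S2 y.
Proof.
apply: adjoint_eq => z.
by rewrite -(sqrt_sym b1 s1 p1) SA (sqrt_sym b2 s2 p2).
Qed.

Lemma relative_op_sym : selfadjoint dot T.
Proof.
move=> x y; rewrite /relative_op /= dotBl dotBr adjA.
by rewrite -[in RHS](dotC _ (A _)) adjA (dotC _ (adjoint _ _ _ x)).
Qed.

(** S1 A = S2 and A^* S1 = S2, so the sandwich removes the inverse square root. *)
Lemma relative_op_sandwich y : S1 (T (S1 y)) = C2 y - C1 y.
Proof.
have -> : T (S1 y) = A (adjoint dot dot A (S1 y)) - S1 y by [].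
by rewrite (linB (sqrt_lin b1 s1 p1)) SA adjAS !sqrt_sqr.
Qed.

(** T + 1 = A A^*, so the point is that A^* is injective: its kernel is orthogonal to the range of
    A, which contains that of S1 by [le12], and S1 is symmetric and injective. *)
Lemma relative_op_gt x : x != 0 -> 0 < '[T x, x] + '[x, x].
Proof.
rewrite /relative_op dotBl subrK [X in _ < X]adjA => x0.
rewrite lt_neqAle dot_ge0 andbT eq_sym; apply: contra_neqN x0 => /eqP/dot_eq0 h.
apply: (sqrt_inj b1 s1 p1); apply: (@dot_inj _ _ dot) => y.
have [z _ zE] := sqrt_range_le b2 s2 p2 b1 s1 p1 K0 le12 (S1 y).
have Az : A z = S1 y by apply: S1_eq; rewrite SA.
by rewrite (sqrt_sym b1 s1 p1) dot0l -Az dotC adjA h dot0r.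
Qed.

(* The two sides agree on the range of S1; by symmetry they then agree
   everywhere, S1 being injective, without any density argument. *)
Lemma relative_op_finite_rank N (a : nat -> H) (eps : nat -> R) :
  (forall y, C2 y - C1 y = \sum_(k < N) (eps k * '[y, S1 (a k)]) *: S1 (a k)) ->
  forall x, T x = \sum_(k < N) (eps k * '[x, a k]) *: a k.
Proof.
move=> CE x; apply: S1_eq; apply: (@dot_inj _ _ dot) => y.
rewrite !(sqrt_sym b1 s1 p1) relative_op_sym.
have -> : T (S1 y) = \sum_(k < N) (eps k * '[S1 y, a k]) *: a k.
  apply: S1_eq; rewrite relative_op_sandwich CE (lin_sum (sqrt_lin b1 s1 p1)).
  apply: eq_bigr => k _; rewrite (linZ (sqrt_lin b1 s1 p1)).
  by rewrite -(sqrt_sym b1 s1 p1).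
rewrite dot_sumr dot_suml; apply: eq_bigr => k _.
by rewrite dotZl dotZr (dotC _ (a k)); ring.
Qed.

End pair.

End relative_operator.

Section bounded_operators.
Context (R : realType) (H : completeNormedModType R) (dot : {dot H for idfun}).
Hypothesis hdot : hilbert dot.
Local Notation "''[' x , y ]" := (dot x y).

Lemma finite_rank_bounded p (a : nat -> H) (eps : nat -> R) :
  bounded_operator (fun x => \sum_(k < p) (eps k * '[x, a k]) *: a k).
Proof.
split.
  move=> c x y; rewrite scaler_sumr -big_split; apply: eq_bigr => k _ /=.
  by rewrite dotDl dotZl scalerA -scalerDl; congr (_ *: _); ring.
exists (\sum_(k < p) `|eps k| * `|a k| ^+ 2) => x.
rewrite mulr_suml; apply: le_trans (ler_norm_sum _ _ _) _.
apply: ler_sum => k _; rewrite normrZ normrM expr2 -!mulrA ler_wpM2l//.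
by rewrite mulrA [leRHS]mulrC mulrA ler_wpM2r// norm_dot_le.
Qed.

Lemma bounded_operatorB (A B : H -> H) :
  bounded_operator A -> bounded_operator B ->
  bounded_operator (fun x => A x - B x).
Proof.
move=> [linA [M AM]] [linB' [N BN]]; split.
  by move=> a x y; rewrite linA linB' scalerBr opprD addrACA.
exists (M + N) => x; apply: le_trans (ler_normB _ _) _.
by rewrite mulrDl lerD.
Qed.

End bounded_operators.

(** The equations are indexed by any finite type, so that two families of constraints can be joined
    in a disjoint sum. *)
Lemma nontrivial_solution (R : fieldType) (L : finType) N (F : nat -> L -> R) :
  (#|L| < N)%N -> exists c : nat -> R,
    (exists2 i, (i < N)%N & c i != 0) /\
    forall l, \sum_(i < N) c i * F i l = 0.
Proof.
case: N => // N LN; pose M : 'M[R]_(N.+1, #|L|) := \matrix_(i, l) F i (enum_val l).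
have : kermx M != 0.
  rewrite kermx_eq0 /row_free neq_ltn (leq_ltn_trans (rank_leq_col M))//.
move=> /rowV0Pn[v /sub_kermxP vM v0].
exists (fun i => v 0 (inord i)); split.
  have /rV0Pn[i vi] := v0; exists i => //; by rewrite inord_val.
move=> l; have /rowP/(_ (enum_rank l)) := vM; rewrite !mxE => {2}<-.
by apply: eq_bigr => i _; rewrite mxE enum_rankK inord_val.
Qed.

(** * Low-rank updates of the prior covariance *)

Section low_rank_updates.
Context (R : realType) (H : completeNormedModType R) (dot : {dot H for idfun}).
Hypothesis hdot : hilbert dot.
Local Notation "''[' x , y ]" := (dot x y).
Implicit Types x y z : H.
Variable Cpr : H -> H.
Hypotheses (bpr : bounded_operator Cpr) (spr : selfadjoint dot Cpr).
Hypothesis ppr : positive dot Cpr.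
Local Notation S0 := (sqrt_op dot Cpr).
Let S0sym := sqrt_sym hdot bpr spr ppr.

(** The common normal form of the posterior, of its truncations and of all competitors: in the
    coordinates S0 x it is the identity minus a diagonal operator. *)
Definition low_rank_update p (u : nat -> H) (sg : nat -> R) : H -> H :=
  fun x => Cpr x - \sum_(k < p) (sg k * '[x, S0 (u k)]) *: S0 (u k).

Definition update_data p (u : nat -> H) (sg : nat -> R) :=
  [/\ orthonormal_upto dot p u, forall k, (k < p)%N -> range S0 (u k) &
      forall k, (k < p)%N -> 0 <= sg k < 1].

Lemma low_rank_update_dot p u sg x y : '[low_rank_update p u sg x, y] =
  '[S0 x, S0 y] - \sum_(k < p) sg k * '[S0 x, u k] * '[S0 y, u k].
Proof.
rewrite dotBl sqrt_dot// dot_suml; congr (_ - _); apply: eq_bigr => k _.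
by rewrite dotZl -S0sym (S0sym (u k)) (dotC _ (u k)).
Qed.

Lemma low_rank_update_sym p u sg : selfadjoint dot (low_rank_update p u sg).
Proof.
move=> x y; rewrite [RHS]dotC !low_rank_update_dot (dotC _ (S0 y)).
by congr (_ - _); apply: eq_bigr => k _; rewrite mulrAC.
Qed.

Lemma low_rank_update_bounded p u sg :
  bounded_operator (low_rank_update p u sg).
Proof.
apply: bounded_operatorB => //.
exact: (finite_rank_bounded hdot p (S0 \o u) sg).
Qed.

Section bounds.
Variables (p : nat) (u : nat -> H) (sg : nat -> R).
Hypothesis ud : update_data p u sg.

Lemma low_rank_update_le x : '[low_rank_update p u sg x, x] <= '[S0 x, S0 x].
Proof.
rewrite low_rank_update_dot gerBl sumr_ge0// => k _.
case: ud => _ _ /(_ k (ltn_ord k))/andP[s0 _].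
by rewrite -mulrA mulr_ge0// -expr2 sqr_ge0.
Qed.

Lemma low_rank_update_ge : exists2 c : R, 0 < c &
  forall x, c * '[S0 x, S0 x] <= '[low_rank_update p u sg x, x].
Proof.
have [up _ s01] := ud.
(* Finitely many sg k < 1 have a maximum below 1, and 1 - t is the constant; starting at 0 settles p
   = 0. *)
pose t := \big[Order.max/0]_(k < p) sg k.
have t1 : t < 1 by apply: bigmax_lt => // k _; have /andP[] := s01 k (ltn_ord k).
have t0 : 0 <= t by exact: bigmax_ge_id.
have st (k : 'I_p) : sg k <= t by exact: le_bigmax.
exists (1 - t); first by rewrite subr_gt0.
move=> x; rewrite low_rank_update_dot mulrBl mul1r lerD2l lerN2.
apply: le_trans (_ : t * \sum_(k < p) '[S0 x, u k] ^+ 2 <= _).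
  rewrite mulr_sumr; apply: ler_sum => k _.
  by rewrite -mulrA -expr2 ler_wpM2r// sqr_ge0.
by rewrite ler_wpM2l// bessel.
Qed.

Lemma low_rank_update_pos : positive dot (low_rank_update p u sg).
Proof.
move=> x x0; have [c c0 /(_ x)] := low_rank_update_ge; apply: lt_le_trans.
by rewrite mulr_gt0// sqrt_dot// ppr.
Qed.

End bounds.

(** Both forms lie between a positive multiple of |S0 x|^2 and |S0 x|^2; the sum of the inverse
    constants serves in both directions. *)
Lemma low_rank_update_equiv p u sg p' u' sg' :
  update_data p u sg -> update_data p' u' sg' -> exists K : R, [/\ 0 < K,
    forall x, '[low_rank_update p u sg x, x] <=
      K * '[low_rank_update p' u' sg' x, x] &
    forall x, '[low_rank_update p' u' sg' x, x] <=
      K * '[low_rank_update p u sg x, x]].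
Proof.
move=> ud ud'; have [c c0 cP] := low_rank_update_ge ud.
have [c' c'0 c'P] := low_rank_update_ge ud'.
have ic0 : 0 <= c^-1 by rewrite invr_ge0 ltW.
have ic'0 : 0 <= c'^-1 by rewrite invr_ge0 ltW.
exists (c^-1 + c'^-1); split=> [|x|x]; first by rewrite addr_gt0 ?invr_gt0.
- apply: le_trans (low_rank_update_le ud x) _.
  have h := c'P x; have h0 : 0 <= c' * '[S0 x, S0 x] by rewrite mulr_ge0 ?dot_ge0// ltW.
  apply: (@le_trans _ _ (c'^-1 * '[low_rank_update p' u' sg' x, x])).
    by rewrite mulrC ler_pdivlMr// mulrC.
  by rewrite mulrDl lerDr mulr_ge0// (le_trans h0).
- apply: le_trans (low_rank_update_le ud' x) _.
  have h := cP x; have h0 : 0 <= c * '[S0 x, S0 x] by rewrite mulr_ge0 ?dot_ge0// ltW.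
  apply: (@le_trans _ _ (c^-1 * '[low_rank_update p u sg x, x])).
    by rewrite mulrC ler_pdivlMr// mulrC.
  by rewrite mulrDl lerDl mulr_ge0// (le_trans h0).
Qed.

Section relative.
Variables (p : nat) (u : nat -> H) (sg : nat -> R).
Variables (p' : nat) (u' : nat -> H) (sg' : nat -> R).
Hypotheses (ud : update_data p u sg) (ud' : update_data p' u' sg').
Local Notation C1 := (low_rank_update p u sg).
Local Notation C2 := (low_rank_update p' u' sg').
Local Notation S1 := (sqrt_op dot C1).
Local Notation T := (relative_op dot C2 C1).
Let b1 := low_rank_update_bounded p u sg.
Let s1 := @low_rank_update_sym p u sg.
Let p1 := low_rank_update_pos ud.
Let b2 := low_rank_update_bounded p' u' sg'.
Let s2 := @low_rank_update_sym p' u' sg'.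
Let p2 := low_rank_update_pos ud'.

Lemma update_sqrt_dot x y : '[S1 x, S1 y] = '[C1 x, y].
Proof. exact: sqrt_dot. Qed.

Lemma update_relative_op_finite_rank N (a : nat -> H) (eps : nat -> R) :
  (forall y, C2 y - C1 y = \sum_(k < N) (eps k * '[y, S1 (a k)]) *: S1 (a k)) ->
  forall x, T x = \sum_(k < N) (eps k * '[x, a k]) *: a k.
Proof.
have [K [K0 le12 le21]] := low_rank_update_equiv ud ud'.
exact: (relative_op_finite_rank hdot b1 s1 p1 b2 s2 p2 K0 le21).
Qed.

Lemma update_relative_op_dot y :
  '[T (S1 y), S1 y] = '[C2 y, y] - '[C1 y, y].
Proof.
have [K [K0 le12 le21]] := low_rank_update_equiv ud ud'.
by rewrite -sqrt_sym// (relative_op_sandwich hdot b1 s1 p1 b2 s2 p2 K0 le21) dotBl.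
Qed.

Lemma update_relative_op_sandwich y : S1 (T (S1 y)) = C2 y - C1 y.
Proof.
have [K [K0 le12 le21]] := low_rank_update_equiv ud ud'.
exact: (relative_op_sandwich hdot b1 s1 p1 b2 s2 p2 K0 le21).
Qed.

Lemma update_sqrt_sqr y : S1 (S1 y) = C1 y.
Proof. exact: sqrt_sqr. Qed.

Lemma update_sqrt_sym x y : '[S1 x, y] = '[x, S1 y].
Proof. exact: sqrt_sym. Qed.

(** This rewrites the vectors S0 (u k) of an update as S1 (a k), the form in which
    [relative_op_finite_rank] takes them. *)
Lemma prior_range_sub x : exists a, S1 a = S0 x.
Proof.
have [c c0 cP] := low_rank_update_ge ud.
have c1 : 0 < c^-1 by rewrite invr_gt0.
have h y : '[Cpr y, y] <= c^-1 * '[C1 y, y].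
  by rewrite mulrC ler_pdivlMr// mulrC -(sqrt_dot hdot bpr).
by have [a _ aE] := sqrt_range_le hdot b1 s1 p1 bpr spr ppr c1 h x; exists a.
Qed.

Lemma update_relative_op_diag : exists q e (mu : nat -> R),
  [/\ orthonormal_upto dot q e,
    forall x, T x = \sum_(j < q) (mu j * '[x, e j]) *: e j &
    forall j, (j < q)%N -> -1 < mu j].
Proof.
have [a aE] := choice (fun k => prior_range_sub (u k)).
have [a' a'E] := choice (fun k => prior_range_sub (u' k)).
(* C2 - C1 adds back the p terms of C1 and removes the p' terms of C2; the two lists are
   concatenated. *)
pose b k := if (k < p)%N then a k else a' (k - p)%N.
pose eps k := if (k < p)%N then sg k else - sg' (k - p)%N.
have TE := @update_relative_op_finite_rank (p + p') b eps.
have {}TE x : T x = \sum_(k < p + p') (eps k * '[x, b k]) *: b k.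
  apply: TE => y; rewrite big_split_ord /=.
  transitivity (\sum_(k < p) (sg k * '[y, S0 (u k)]) *: S0 (u k) -
      \sum_(k < p') (sg' k * '[y, S0 (u' k)]) *: S0 (u' k)).
    by rewrite /low_rank_update opprB [LHS]addrC addrA subrK.
  rewrite -sumrN; congr (_ + _); apply: eq_bigr => k _; rewrite /eps /b.
    by rewrite ltn_ord aE.
  by rewrite ltnNge leq_addr /= addKn a'E mulNr scaleNr.
have [q [e [mu [_ eo _ muE]]]] := finite_rank_diag dot (p + p') b eps.
exists q, e, mu; split => // [x|j jq]; first by rewrite TE muE.
have [K [K0 le12 le21]] := low_rank_update_equiv ud ud'.
have ej0 : e j != 0.
  apply/eqP => ej; have := eo j j jq jq; rewrite ej dot0l eqxx => /eqP.
  by rewrite eq_sym oner_eq0.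
have := relative_op_gt hdot b1 s1 p1 b2 s2 p2 K0 le12 le21 ej0.
rewrite TE muE (orthonormal_sum eo (fun k => mu k * '[e j, e k]))// eo// eqxx mulr1.
by rewrite -ltrBlDr sub0r.
Qed.

End relative.

End low_rank_updates.

(** * Losses *)

Section loss_functions.
Context (R : realType) (f : R -> R).
Hypothesis lf : loss_class f.

Lemma loss_nonincreasing x y : -1 < x -> x <= y -> y <= 0 -> f y <= f x.
Proof.
move=> x1 xy y0; have df z : z \in `[x, 0]%R -> derivable f z 1.
  rewrite in_itv /= => /andP[xz _]; apply: loss_derivable lf _ _.
  exact: lt_le_trans xz.
have h := @ler0_derive1_le_cc R f x 0 _ _ (derivable_within_continuous df).
apply: h => // [z|z||].
- rewrite in_itv /= => /andP[xz z0]; apply: df.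
  by rewrite in_itv /= !ltW.
- rewrite in_itv /= => /andP[xz z0].
  have := loss_sign lf (lt_trans x1 xz); rewrite lt_eqF// => /(_ isT).
  by rewrite nmulr_rgt0// => /ltW.
- by rewrite in_itv /= xy.
- by rewrite in_itv /= lexx (le_trans xy).
Qed.

Lemma loss_ge0 x : -1 < x -> 0 <= f x.
Proof.
move=> x1; rewrite -(loss_at0 lf); have [x0|/ltW x0] := leP x 0.
  exact: loss_nonincreasing.
have df z : z \in `[0, x]%R -> derivable f z 1.
  rewrite in_itv /= => /andP[z0 _]; apply: loss_derivable lf _ _.
  by apply: lt_le_trans z0; rewrite ltrN10.
have h := @ger0_derive1_le_cc R f 0 x _ _ (derivable_within_continuous df).
apply: h => // [z|z||].
- rewrite in_itv /= => /andP[z0 zx]; apply: df.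
  by rewrite in_itv /= !ltW.
- rewrite in_itv /= => /andP[z0 zx].
  have := loss_sign lf (lt_trans (ltrN10 _) z0); rewrite gt_eqF// => /(_ isT).
  by rewrite pmulr_rgt0// => /ltW.
- by rewrite in_itv /= lexx.
- by rewrite in_itv /= lexx x0.
Qed.

End loss_functions.

Lemma loss_class_sqr (R : realType) : loss_class (fun x : R => x ^+ 2).
Proof.
have d1 (x : R) : derive1 (fun x : R => x ^+ 2) x = 2 * x.
  by rewrite exp_derive1 expr1.
split=> [x _|x _||||].
- exact: (@exprn_derivable _ 2 x 1).
- rewrite (_ : derive1 _ = (fun x : R => 2 * x)); last by apply/funext.
  by apply: cvgMl_tmp; exact: cvg_id.
- by rewrite expr0n.
- move=> x _ x0; rewrite d1 mulrCA -expr2 mulr_gt0// lt_neqAle sqr_ge0 andbT.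
  by rewrite eq_sym sqrf_eq0.
- exact: cvgr_expr2.
- exists setT; first exact: filterT.
  rewrite (_ : derive1 _ = (fun x : R => 2 * x)); last by apply/funext.
  apply: (@klipschitzW _ _ _ 2).
    exact: (@globally_properfilter _ _ (0, 0)).
  by move=> [x y] _; rewrite /self_sub /= -mulrBr normrM ger0_norm.
Qed.

(** * Optimality of the spectral truncation *)

Lemma big_ord_split_at (V : nmodType) n m (F : nat -> V) : (n <= m)%N ->
  \sum_(k < m) F k = \sum_(k < n) F k + \sum_(i < m - n) F (n + i)%N.
Proof.
move=> nm; rewrite -!(big_mkord xpredT F) -(big_mkord xpredT (fun i => F (n + i)%N)).
rewrite (big_cat_nat _ nm)//=; congr (_ + _).
by rewrite -{1}[n]add0n big_addn; apply: eq_bigr => i _; rewrite addnC.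
Qed.

Section optimality.
Context (R : realType) (H : completeNormedModType R) (dot : {dot H for idfun}).
Hypothesis hdot : hilbert dot.
Local Notation "''[' x , y ]" := (dot x y).
Implicit Types x y z : H.
Variable Cpr : H -> H.
Hypotheses (bpr : bounded_operator Cpr) (spr : selfadjoint dot Cpr).
Hypothesis ppr : positive dot Cpr.
Local Notation S0 := (sqrt_op dot Cpr).
Let S0lin := sqrt_lin hdot bpr spr ppr.
Let S0sym := sqrt_sym hdot bpr spr ppr.
Let S0sqr := sqrt_sqr hdot bpr spr ppr.
Variables (d : option nat) (b : nat -> H).
Hypothesis bb : orthonormal_basis dot d b.
Variables (m : nat) (lam : nat -> R) (w : nat -> H).
Hypothesis wo : orthonormal_upto dot m w.
Hypothesis wr : forall i, (i < m)%N -> range S0 (w i).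
Hypothesis lam_gt : forall i, -1 < lam i.
Hypothesis lam_lt0 : forall i, (i < m)%N -> lam i < 0.
Hypothesis lam_eq0 : forall i, (m <= i)%N -> lam i = 0.
Hypothesis lam_mono : forall i j, (i <= j)%N -> lam i <= lam j.

Local Notation update := (low_rank_update dot Cpr).
Local Notation Cp := (update m w (fun i => - lam i)).

Lemma spectral_upto n : (n <= m)%N -> orthonormal_upto dot n w.
Proof.
by move=> nm i j ni nj; apply: wo; exact: leq_trans nm.
Qed.

Let lam_le0 i : lam i <= 0.
Proof.
by have [mi|im] := leqP m i; [rewrite lam_eq0|exact/ltW/lam_lt0].
Qed.

Lemma spectral_update_data n : (n <= m)%N ->
  update_data dot Cpr n w (fun i => - lam i).
Proof.
move=> nm; split; first exact: spectral_upto.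
  by move=> k kn; apply: wr; exact: leq_trans nm.
by move=> k _; rewrite oppr_ge0 lam_le0 ltrNl lam_gt.
Qed.

Let udp := spectral_update_data (leqnn m).

Lemma spectral_preimage : exists g : nat -> H, forall i, (i < m)%N -> S0 (g i) = w i.
Proof.
suff /choice[g gP] : forall i, exists y, (i < m)%N -> S0 y = w i by exists g.
move=> i; have [im|im] := leqP m i; first by exists 0.
by have [y _ yE] := wr im; exists y.
Qed.

Lemma in_span_prefix n x : (n <= m)%N -> in_span n w x ->
  forall i, (n <= i)%N -> (i < m)%N -> '[x, w i] = 0.
Proof.
move=> nm xn i ni im; apply: in_span_orth xn => k kn.
by rewrite wo// ?ltn_eqF ?(leq_trans kn).
Qed.

(** * Lower bound and rigidity for one competitor *)

Section competitor.
Variables (r p : nat) (u : nat -> H) (sg : nat -> R).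
Hypotheses (pr : (p <= r)%N) (ud : update_data dot Cpr p u sg).
Local Notation C := (update p u sg).
Local Notation S1 := (sqrt_op dot C).
Local Notation T := (relative_op dot Cp C).
Let S1lin := sqrt_lin hdot (low_rank_update_bounded hdot bpr p u sg)
  (@low_rank_update_sym _ _ _ hdot _ bpr spr ppr p u sg)
  (low_rank_update_pos hdot bpr spr ppr ud).

Lemma rayleigh y : '[T (S1 y), S1 y] =
  \sum_(i < m) lam i * '[S0 y, w i] ^+ 2 + \sum_(k < p) sg k * '[S0 y, u k] ^+ 2.
Proof.
rewrite update_relative_op_dot// !low_rank_update_dot//.
rewrite opprB [LHS]addrC addrA subrK addrC -sumrN.
by congr (_ + _); apply: eq_bigr => k _; rewrite -?mulNr ?opprK -mulrA.
Qed.

Lemma update_dot_orth x y : (forall k, (k < p)%N -> '[S0 x, u k] = 0) ->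
  '[S1 x, S1 y] = '[S0 x, S0 y].
Proof.
move=> xu; rewrite update_sqrt_dot// low_rank_update_dot// big1 ?subr0// => k _.
by rewrite xu// mulr0 mul0r.
Qed.

(** The r + k + 1 coordinates of S0 y along w face p + size s <= r + k equations. Orthogonality to u
    is imposed on S0 y, orthogonality to s on S1 y; both are linear in the coordinates through the
    preimages g i. *)
Lemma test_vector k (s : seq H) : (r + k < m)%N -> (size s <= k)%N ->
  exists y, [/\ '[S0 y, S0 y] = 1, in_span (r + k).+1 w (S0 y),
    forall l, (l < p)%N -> '[S0 y, u l] = 0 &
    forall z, z \in s -> '[S1 y, z] = 0].
Proof.
move=> rkm sk; have [g gE] := spectral_preimage.
pose F i (l : 'I_p + 'I_(size s)) :=
  match l with inl l => '[w i, u l] | inr j => '[S1 (g i), nth 0 s j] end.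
have [|c [[i0 i0N ci0] cF]] := @nontrivial_solution R _ (r + k).+1 F.
  by rewrite card_sum !card_ord ltnS leq_add.
pose y0 := \sum_(i < (r + k).+1) c i *: g i.
have Sy0 : S0 y0 = \sum_(i < (r + k).+1) c i *: w i.
  rewrite (lin_sum S0lin); apply: eq_bigr => i _.
  by rewrite (linZ S0lin) gE// (leq_trans (ltn_ord i)).
have Sy00 : S0 y0 != 0.
  apply: contraNneq ci0 => h.
  by rewrite -(orthonormal_sum (spectral_upto rkm) c i0N) -Sy0 h dot0l.
have [t t0 tt] := normalize dot Sy00.
exists (t *: y0); rewrite (linZ S0lin); split => //.
- by apply: in_spanZ; rewrite Sy0; exists c.
- move=> l lp; rewrite dotZl Sy0 dot_suml.
  have := cF (inl (Ordinal lp)); rewrite /F /= => h.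
  under eq_bigr do rewrite dotZl.
  by rewrite h mulr0.
- move=> z /(nthP 0)[j js <-].
  have := cF (inr (Ordinal js)); rewrite /F /= => h.
  rewrite (linZ S1lin) dotZl (lin_sum S1lin) dot_suml.
  under eq_bigr do rewrite (linZ S1lin) dotZl.
  by rewrite h mulr0.
Qed.

(** The squares <S0 y, w i>^2 add up to 1. With [lam] nondecreasing every term on the right is at
    most 0, which gives the bound, and termwise vanishing when equality holds. *)
Lemma test_vector_rayleigh k y : (r + k < m)%N -> '[S0 y, S0 y] = 1 ->
  in_span (r + k).+1 w (S0 y) -> (forall l, (l < p)%N -> '[S0 y, u l] = 0) ->
  '[T (S1 y), S1 y] - lam (r + k) =
    \sum_(i < (r + k).+1) (lam i - lam (r + k)) * '[S0 y, w i] ^+ 2.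
Proof.
move=> rkm y1 yw yu; rewrite rayleigh.
rewrite [X in _ + X - _]big1 ?addr0 => [|l _]; last by rewrite yu// expr0n mulr0.
have -> : \sum_(i < m) lam i * '[S0 y, w i] ^+ 2 =
    \sum_(i < (r + k).+1) lam i * '[S0 y, w i] ^+ 2.
  rewrite [RHS](big_ord_widen _ (fun i => lam i * '[S0 y, w i] ^+ 2) rkm).
  rewrite [RHS]big_mkcond; apply: eq_bigr => i _; case: ltnP => // h.
  by rewrite (in_span_prefix rkm yw)// expr0n mulr0.
have y1' : \sum_(i < (r + k).+1) '[S0 y, w i] ^+ 2 = 1.
  rewrite -y1 [in RHS](in_spanE (spectral_upto rkm) yw).
  rewrite (orthonormal_sum_sum (spectral_upto rkm) (fun i => '[S0 y, w i])
    (fun i => '[S0 y, w i])).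
  by apply: eq_bigr => i _; rewrite expr2.
rewrite -[X in _ - X]mulr1 -y1' mulr_sumr -sumrN -big_split.
by apply: eq_bigr => i _ /=; rewrite mulrBl.
Qed.

Lemma test_vector_le k y : (r + k < m)%N -> '[S0 y, S0 y] = 1 ->
  in_span (r + k).+1 w (S0 y) -> (forall l, (l < p)%N -> '[S0 y, u l] = 0) ->
  '[T (S1 y), S1 y] <= lam (r + k).
Proof.
move=> rkm y1 yw yu; rewrite -subr_le0 test_vector_rayleigh//.
apply: sumr_le0 => i _; rewrite mulr_le0_ge0 ?sqr_ge0// subr_le0.
by apply: lam_mono; rewrite -ltnS.
Qed.

(* A test vector orthogonal to the e j with j in J would otherwise have a
   Rayleigh quotient larger than lam (r + k). *)
Lemma new_eigenvalue q e (mu : nat -> R) (J : {set 'I_q}) k :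
  orthonormal_upto dot q e ->
  (forall x, T x = \sum_(j < q) (mu j * '[x, e j]) *: e j) ->
  (#|J| <= k)%N -> (r + k < m)%N -> exists2 j, j \notin J & mu j <= lam (r + k).
Proof.
move=> eo TE Jk rkm; apply: contrapT => no.
have mu_gt j : j \notin J -> lam (r + k) < mu j.
  by move=> jJ; rewrite ltNge; apply/negP => h; apply: no; exists j.
have [|y [y1 yw yu ys]] := @test_vector k [seq e (val j) | j <- enum J] rkm.
  by rewrite size_map -cardE.
have := test_vector_le rkm y1 yw yu; rewrite leNgt => /negP; apply.
(* Including 0 in the minimum accounts for the directions outside the e j, where T vanishes: t <= 0
   is what turns Bessel into t <= t * sum. It keeps t > lam (r + k), as lam (r + k) < 0. *)
pose t := \big[Order.min/0]_(j | j \notin J) mu j.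
have tgt : lam (r + k) < t.
  by apply: lt_bigmin => [|j jJ]; [exact: lam_lt0|exact: mu_gt].
have t0 : t <= 0 by exact: bigmin_le_id.
apply: (lt_le_trans tgt).
have z1 : '[S1 y, S1 y] = 1 by rewrite update_dot_orth.
rewrite TE dot_suml.
apply: (@le_trans _ _ (t * \sum_(j < q) '[S1 y, e j] ^+ 2)).
  rewrite -[leLHS]mulr1; apply: ler_wnM2l => //.
  by rewrite -z1; exact: bessel.
rewrite mulr_sumr; apply: ler_sum => j _; rewrite dotZl (dotC _ (e j)).
rewrite -mulrA -expr2; have [jJ|jJ] := boolP (j \in J).
  by rewrite ys ?expr0n ?mulr0//; apply: map_f; rewrite mem_enum.
by rewrite ler_wpM2r ?sqr_ge0//; exact: bigmin_le_cond.
Qed.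

Lemma loss_eigenvalues f : loss_class f -> exists q e (mu : nat -> R),
  [/\ orthonormal_upto dot q e,
    forall x, T x = \sum_(j < q) (mu j * '[x, e j]) *: e j,
    forall j, (j < q)%N -> -1 < mu j &
    loss dot f Cp C = \sum_(j < q) f (mu j)].
Proof.
move=> lf; have [q [e [mu [eo TE mu1]]]] :=
  update_relative_op_diag hdot bpr spr ppr ud udp.
exists q, e, mu; split => //.
exact: (spectral_sumE hdot bb eo (loss_at0 lf) TE).
Qed.

Lemma loss_lower_bound f : loss_class f ->
  \sum_(i < m - r) f (lam (r + i)) <= loss dot f Cp C.
Proof.
move=> lf; have [q [e [mu [eo TE mu1 ->]]]] := loss_eigenvalues lf.
suff [J _ Jle] : exists2 J : {set 'I_q}, #|J| = (m - r)%N &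
    \sum_(i < m - r) f (lam (r + i)) <= \sum_(j in J) f (mu j).
  apply: le_trans Jle _; rewrite big_mkcond; apply: ler_sum => j _.
  by case: ifP => // _; exact/(loss_ge0 lf)/mu1.
suff /(_ (m - r)%N (leqnn _)) : forall k, (k <= m - r)%N ->
  exists2 J : {set 'I_q}, #|J| = k &
    \sum_(i < k) f (lam (r + i)) <= \sum_(j in J) f (mu j) by [].
elim=> [_|k IH km]; first by exists finset.set0; rewrite ?cards0// big_ord0 finset.big_set0.
have [J Jk Jle] := IH (ltnW km).
have rkm : (r + k < m)%N by rewrite -ltn_subRL.
have [|j jJ muj] := new_eigenvalue (J := J) (k := k) eo TE _ rkm.
  by rewrite Jk.
exists (j |: J)%SET; first by rewrite cardsU1 jJ Jk.
rewrite big_ord_recr finset.big_setU1//= addrC lerD//.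
by apply: loss_nonincreasing => //; exact: mu1.
Qed.


(** Here the k spare conditions make S1 (y k) orthogonal to its predecessors rather than to
    eigenvectors, so that the S1 (y k) form the orthonormal family of the rigidity argument. *)
Lemma test_sequence n : (n <= m - r)%N -> exists y : nat -> H,
  forall k, (k < n)%N -> [/\ '[S0 (y k), S0 (y k)] = 1,
    in_span (r + k).+1 w (S0 (y k)),
    forall l, (l < p)%N -> '[S0 (y k), u l] = 0 &
    forall i, (i < k)%N -> '[S1 (y k), S1 (y i)] = 0].
Proof.
elim: n => [_|n IH nm]; first by exists (fun=> 0).
have [y yP] := IH (ltnW nm).
have rnm : (r + n < m)%N by rewrite -ltn_subRL.
have [|y' [y1 yw yu ys]] := test_vector (k := n) (s := [seq S1 (y i) | i <- iota 0 n]) rnm.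
  by rewrite size_map size_iota.
exists (fun k => if k == n then y' else y k) => k; rewrite ltnS leq_eqVlt.
have [-> _|kn /= kn'] := eqVneq k n.
  split => // i ik; rewrite ltn_eqF// ys//.
  by apply: map_f; rewrite mem_iota.
have [h1 h2 h3 h4] := yP k kn'; split => // i ik.
by rewrite ltn_eqF ?h4// (ltn_trans ik).
Qed.

(** Vacuous for m <= r, which is the case lambda_(r+1) = 0. *)
Hypothesis gap : forall i, (r < m)%N -> (i < r)%N -> lam i < lam r.

Lemma spectral_tail n y : (n <= m)%N ->
  Cp y - update n w (fun i => - lam i) y =
  \sum_(i < m - n) (lam (n + i)%N * '[y, S0 (w (n + i)%N)]) *: S0 (w (n + i)%N).
Proof.
move=> nm; rewrite /low_rank_update opprB [LHS]addrC addrA subrK.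
pose F i := (- lam i * '[y, S0 (w i)]) *: S0 (w i).
rewrite (big_ord_split_at F nm) opprD addrA subrr add0r -sumrN; apply: eq_bigr => i _.
by rewrite /F mulNr scaleNr opprK.
Qed.

Lemma sqr_loss_unique :
  loss dot (fun t : R => t ^+ 2) Cp C <= \sum_(i < m - r) lam (r + i)%N ^+ 2 ->
  forall x, C x = update (minn r m) w (fun i => - lam i) x.
Proof.
have [q [e [mu [eo TE _ ->]]]] := loss_eigenvalues (loss_class_sqr R) => le.
have sandwich y : C y = Cp y - S1 (T (S1 y)).
  by rewrite update_relative_op_sandwich// opprB addrC subrK.
(* For m <= r the bound is 0, so T = 0 and C is the posterior itself. *)
have [mr|rm] := leqP m r.
  move=> x; move: le; have -> : (m - r)%N = 0%N by apply/eqP; rewrite subn_eq0.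
  rewrite big_ord0 => le0.
  have mu0 (j : 'I_q) : mu j = 0.
    apply/eqP; rewrite -sqrf_eq0; have : \sum_(j < q) mu j ^+ 2 == 0.
      by rewrite eq_le le0 sumr_ge0// => i _; exact: sqr_ge0.
    by rewrite psumr_eq0 => [/allP/(_ j)|i _]; [apply; exact: mem_index_enum|exact: sqr_ge0].
  rewrite sandwich TE big1 ?(lin0 S1lin) ?subr0// => j _.
  by rewrite mu0 mul0r scale0r.
have [y yP] := test_sequence (leqnn (m - r)).
pose z k := S1 (y k); pose X k := S0 (y k).
have lt_rk k : (k < m - r)%N -> (r + k < m)%N by rewrite ltn_subRL.
have zX i j : (i < m - r)%N -> '[z i, z j] = '[X i, X j].
  by move=> /yP[_ _ h _]; exact: update_dot_orth.
have zo : orthonormal_upto dot (m - r) z.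
  move=> i j im jm; case: (ltngtP i j) => [ij|ji|->].
  - by rewrite dotC; have [_ _ _ ->] := yP j jm.
  - by have [_ _ _ ->] := yP i im.
  - by rewrite zX//; have [-> _ _ _] := yP j jm.
have Xo : orthonormal_upto dot (m - r) X by move=> i j im jm; rewrite -zX ?zo.
have tau_le k : (k < m - r)%N -> '[T (z k), z k] <= lam (r + k).
  by move=> km; have [h1 h2 h3 _] := yP k km; apply: test_vector_le => //; exact: lt_rk.
(* Both numbers are at most 0, so squaring reverses [tau_le]. *)
have sq_le k : (k < m - r)%N -> lam (r + k)%N ^+ 2 <= '[T (z k), z k] ^+ 2.
  move=> km; have := tau_le k km; have := lam_le0 (r + k); nra.
have le' : \sum_(j < q) mu j ^+ 2 <= \sum_(k < m - r) '[T (z k), z k] ^+ 2.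
  by apply: le_trans le _; apply: ler_sum => k _; exact: sq_le.
have [TE' eq_sum] := hilbert_schmidt_rigidity eo zo TE le'.
have tauE k : (k < m - r)%N -> '[T (z k), z k] = lam (r + k).
  move=> km.
  have : \sum_(k < m - r) ('[T (z k), z k] ^+ 2 - lam (r + k)%N ^+ 2) == 0.
    rewrite eq_le sumr_ge0 ?andbT => [|i _]; last by rewrite subr_ge0 sq_le.
    by rewrite sumrB -eq_sum subr_le0.
  rewrite psumr_eq0 => [/allP/(_ (Ordinal km) (mem_index_enum _))|i _]; last first.
    by rewrite subr_ge0 sq_le.
  rewrite subr_eq0 => /eqP /=; have := tau_le k km; have := lam_le0 (r + k).
  nra.
(* The left side of [test_vector_rayleigh] is now 0, and its right side is a sum of terms of one
   sign. *)
have lamX k i : (k < m - r)%N -> (i < (r + k).+1)%N ->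
    (lam i - lam (r + k)) * '[X k, w i] ^+ 2 = 0.
  move=> km irk; have [h1 h2 h3 _] := yP k km.
  have := test_vector_rayleigh (lt_rk _ km) h1 h2 h3.
  rewrite tauE// subrr => /esym/eqP; rewrite -oppr_eq0 -sumrN psumr_eq0.
    by move=> /allP/(_ (Ordinal irk) (mem_index_enum _)); rewrite oppr_eq0 => /eqP.
  move=> j _; rewrite oppr_ge0 mulr_le0_ge0 ?sqr_ge0// subr_le0.
  by apply: lam_mono; rewrite -ltnS.
have Xw0 k i : (k < m - r)%N -> (i < r)%N -> '[X k, w i] = 0.
  move=> km ir; have irk : (i < (r + k).+1)%N by rewrite ltnS (leq_trans (ltnW ir)) ?leq_addr.
  have /eqP := lamX k i km irk; rewrite mulf_eq0 subr_eq0 sqrf_eq0.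
  rewrite lt_eqF/= => [/eqP//|]; apply: lt_le_trans (gap rm ir) _.
  by apply: lam_mono; exact: leq_addr.
(* The tail of the spectral expansion, in the coordinates S0. The X k have the same Rayleigh
   quotients for it, so rigidity applies a second time and diagonalizes T0 in the X k. *)
pose T0 x := \sum_(i < m - r) (lam (r + i) * '[x, w (r + i)]) *: w (r + i).
have T0X k : (k < m - r)%N -> '[T0 (X k), X k] = lam (r + k).
  move=> km; have [h1 h2 h3 _] := yP k km.
  rewrite -tauE// rayleigh [X in _ = _ + X]big1 ?addr0 => [|l _]; last first.
    by rewrite h3// expr0n mulr0.
  rewrite (big_ord_split_at (fun i => lam i * '[S0 (y k), w i] ^+ 2) (ltnW rm)).
  rewrite big1 ?add0r => [|i _]; last first.
    by rewrite Xw0// expr0n mulr0.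
  rewrite dot_suml; apply: eq_bigr => i _.
  by rewrite dotZl (dotC _ (w _)) expr2 mulrA.
have wro : orthonormal_upto dot (m - r) (fun i => w (r + i)).
  move=> i j im jm; rewrite wo ?lt_rk//.
  by rewrite eqn_add2l.
have T0le : \sum_(i < m - r) lam (r + i) ^+ 2 <= \sum_(k < m - r) '[T0 (X k), X k] ^+ 2.
  by apply: ler_sum => k _; rewrite T0X.
have [T0E _] := hilbert_schmidt_rigidity (T := T0) (mu := fun i => lam (r + i))
  wro Xo (fun=> erefl) T0le.
move=> x.
(* S1 (z k) = C (y k), and C agrees with [Cpr] there because X k is orthogonal to u. This links the
   diagonal forms of T and T0. *)
have S1z k : (k < m - r)%N -> S1 (z k) = S0 (X k).
  move=> km; have [_ _ h _] := yP k km.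
  rewrite /z update_sqrt_sqr// /low_rank_update big1 ?subr0 ?S0sqr// => l _.
  by rewrite -S0sym h// mulr0 scale0r.
have STS : S1 (T (S1 x)) = S0 (T0 (S0 x)).
  rewrite TE' T0E (lin_sum S1lin) (lin_sum S0lin); apply: eq_bigr => k _.
  by rewrite (linZ S1lin) (linZ S0lin) tauE// T0X// update_sqrt_sym// S1z// S0sym.
rewrite sandwich STS -[RHS](subKr (Cp x)) spectral_tail ?(ltnW rm)//.
congr (_ - _); rewrite (lin_sum S0lin); apply: eq_bigr => k _.
by rewrite (linZ S0lin) S0sym.
Qed.

End competitor.

(** The truncation C acts like [Cpr] on g (n + i), because w (n + i) is orthogonal to the retained w
    k. Hence the a i = S1 (g (n + i)) are orthonormal with S1 (a i) = S0 (w (n + i)), and they are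
    eigenvectors for the discarded lambda. *)
Lemma loss_truncation n f : (n <= m)%N -> loss_class f ->
  loss dot f Cp (update n w (fun i => - lam i)) =
  \sum_(i < m - n) f (lam (n + i)%N).
Proof.
move=> nm lf; have [g gE] := spectral_preimage.
pose C := update n w (fun i => - lam i); pose S1 := sqrt_op dot C.
have ud := spectral_update_data nm.
pose a i := S1 (g (n + i)%N).
have lt_nk i : (i < m - n)%N -> (n + i < m)%N by rewrite ltn_subRL.
have S1a i : (i < m - n)%N -> S1 (a i) = S0 (w (n + i)%N).
  move=> im; rewrite /a /S1 update_sqrt_sqr// /C /low_rank_update.
  rewrite big1 ?subr0 => [|k _]; first by rewrite -S0sqr gE// lt_nk.
  rewrite -S0sym gE ?lt_nk// wo ?lt_nk//.
    by rewrite gtn_eqF ?mulr0 ?scale0r// (leq_trans (ltn_ord k)) ?leq_addr.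
  exact: leq_trans nm.
have ao : orthonormal_upto dot (m - n) a.
  move=> i j im jm; rewrite dotC {1}/a /S1 update_sqrt_sym// -/S1 S1a//.
  rewrite -S0sym gE ?lt_nk// wo ?lt_nk//.
  by rewrite eqn_add2l eq_sym.
have TE x : relative_op dot Cp C x =
    \sum_(i < m - n) (lam (n + i)%N * '[x, a i]) *: a i.
  apply: (@update_relative_op_finite_rank _ _ _ hdot _ bpr spr ppr
    n w _ m w _ ud udp _ a (fun i => lam (n + i)%N)) => y.
  by rewrite spectral_tail//; apply: eq_bigr => i _; rewrite -/C -/S1 S1a.
exact: (spectral_sumE (mu := fun i => lam (n + i)%N) hdot bb ao (loss_at0 lf) TE).
Qed.

Lemma truncation_le r p u sg f : (p <= r)%N -> update_data dot Cpr p u sg ->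
  loss_class f -> loss dot f Cp (update (minn r m) w (fun i => - lam i)) <=
    loss dot f Cp (update p u sg).
Proof.
move=> pr ud lf; rewrite loss_truncation ?geq_minr//.
apply: le_trans (loss_lower_bound pr ud lf).
by have [mr|//] := leqP m r; rewrite subnn big_ord0 (eqP mr) big_ord0.
Qed.

End optimality.

(** * The approximation classes *)

Section gram_operators.
Context (R : realType) (H : completeNormedModType R) (dot : {dot H for idfun}).
Hypothesis hdot : hilbert dot.
Local Notation "''[' x , y ]" := (dot x y).

Lemma entry_le_norm n (c : 'cV[R]_n) i : `|c i 0| <= `|c|.
Proof.
rewrite [leRHS]mx_normrE.
exact: (@le_bigmax _ _ _ _ (fun ij => `|c ij.1 ij.2|) (i, 0)).
Qed.

Definition unit_col n (i : nat) : 'cV[R]_n := \col_j (j == i :> nat)%:R.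

Lemma unit_col_sum n (c : 'cV[R]_n) : c = \sum_(i < n) c i 0 *: unit_col n i.
Proof.
apply/colP => j; rewrite summxE (bigD1 j)//= !mxE eqxx mulr1 big1 ?addr0// => i ij.
by rewrite !mxE (_ : (j == i :> nat) = false) ?mulr0//; apply/negbTE; rewrite eq_sym.
Qed.

Lemma gramE r (K : 'cV[R]_r -> H) x : linear K ->
  gram dot K x = \sum_(i < r) '[x, K (unit_col r i)] *: K (unit_col r i).
Proof.
move=> linK; rewrite /gram /=.
have -> : adjoint (euclidean R r) dot K x = \col_i '[x, K (unit_col r i)].
  apply: (adjoint_eq (A := K)) => z.
  rewrite {1}(unit_col_sum z) (lin_sum linK) dot_suml; apply: eq_bigr => i _.
  by rewrite (linZ linK) dotZl mxE dotC.
rewrite {1}(unit_col_sum (\col__ _)) (lin_sum linK); apply: eq_bigr => i _.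
by rewrite (linZ linK) mxE.
Qed.

(** K sends the k-th unit vector to sqrt (eps k) a k, and to 0 for the r - p remaining ones. *)
Lemma gram_exists r p (a : nat -> H) (eps : nat -> R) : (p <= r)%N ->
  (forall k, (k < p)%N -> 0 <= eps k) ->
  exists K : 'cV[R]_r -> H, [/\ bounded_operator K,
    forall x, gram dot K x = \sum_(k < p) (eps k * '[x, a k]) *: a k &
    forall c, in_span p a (K c)].
Proof.
move=> pr eps0; pose b i := (if (i < p)%N then Num.sqrt (eps i) else 0) *: a i.
pose K (c : 'cV[R]_r) := \sum_(i < r) c i 0 *: b i.
have linK : linear K.
  move=> t c c'; rewrite /K scaler_sumr -big_split; apply: eq_bigr => i _ /=.
  by rewrite !mxE scalerDl scalerA.
exists K; split.
- split => //; exists (\sum_(i < r) `|b i|) => c.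
  apply: le_trans (ler_norm_sum _ _ _) _; rewrite mulr_suml; apply: ler_sum => i _.
  by rewrite normrZ mulrC ler_wpM2l// entry_le_norm.
- move=> x; rewrite gramE//.
  have Kb (i : 'I_r) : K (unit_col r i) = b i.
    rewrite /K (bigD1 i)//= mxE eqxx scale1r big1 ?addr0// => j ji.
    by rewrite mxE (_ : (j == i :> nat) = false) ?scale0r//; exact/negbTE.
  rewrite (big_ord_widen _ (fun k => (eps k * '[x, a k]) *: a k) pr).
  rewrite [RHS]big_mkcond; apply: eq_bigr => i _; rewrite Kb /b.
  case: ifP => ip; last by rewrite scale0r scaler0.
  by rewrite dotZr scalerA mulrAC -expr2 sqr_sqrtr ?eps0// mulrC.
- move=> c; rewrite /K; elim/big_rec: _ => [|i y _ IH]; first exact: in_span0.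
  apply: in_spanD => //; apply: in_spanZ; rewrite /b; case: ifP => ip.
    by apply: in_spanZ; exact: in_span_mem.
  by rewrite scale0r; exact: in_span0.
Qed.

Variable Cpr : H -> H.
Hypotheses (bpr : bounded_operator Cpr) (spr : selfadjoint dot Cpr).
Hypothesis ppr : positive dot Cpr.
Local Notation S0 := (sqrt_op dot Cpr).
Let S0lin := sqrt_lin hdot bpr spr ppr.
Let S0sym := sqrt_sym hdot bpr spr ppr.
Let S0sqr := sqrt_sqr hdot bpr spr ppr.
Let S0_eq := sqrt_eq hdot bpr spr ppr.
Local Notation update := (low_rank_update dot Cpr).

Lemma update_cov_class r p u sg : (p <= r)%N -> update_data dot Cpr p u sg ->
  cov_class dot Cpr r (update p u sg).
Proof.
move=> pr ud; have [up ur s01] := ud.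
have [|K [bK KE Kspan]] := @gram_exists r p (S0 \o u) sg pr.
  by move=> k /s01 /andP[].
exists K; split => //; last exact: low_rank_update_pos.
  move=> _ [c _ <-]; case: (Kspan c) => t ->.
  have [linC _] := bpr.
  have /choice[h hE] : forall k, exists h, (k < p)%N -> Cpr h = S0 (u k).
    move=> k; have [pk|kp] := leqP p k; first by exists 0.
    by have [h _ hE] := ur k kp; exists h => _; rewrite -S0sqr hE.
  exists (\sum_(k < p) t k *: h k) => //.
  by rewrite (lin_sum linC); apply: eq_bigr => k _; rewrite (linZ linC) hE.
by apply/funext => x; rewrite KE.
Qed.

(** Writing K e_i = Cpr b_i = S0 (S0 b_i) exhibits K K^* as S0 D S0 with D of finite rank, and D is
    diagonalized. Testing positivity of C at h with S0 h = u k gives 1 - mu k > 0. *)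
Lemma cov_class_update r C : cov_class dot Cpr r C -> exists p u sg,
  [/\ (p <= r)%N, update_data dot Cpr p u sg & C = update p u sg].
Proof.
move=> [K [[linK bK] Kr CE pC]].
have /choice[b bE] : forall i, exists b, Cpr b = K (unit_col r i).
  by move=> i; have [|b _ ?] := Kr (K (unit_col r i)); [exists (unit_col r i)|exists b].
have [p [u [mu [pr up uspan muE]]]] := finite_rank_diag dot r (S0 \o b) (fun=> 1).
have ur k : (k < p)%N -> range S0 (u k).
  move=> /uspan[c ->]; exists (\sum_(i < r) c i *: b i) => //.
  by rewrite (lin_sum S0lin); apply: eq_bigr => i _; rewrite (linZ S0lin).
have CE' : C = update p u mu.
  rewrite CE; apply/funext => x; congr (_ - _); rewrite gramE//.
  transitivity (S0 (\sum_(k < p) (mu k * '[S0 x, u k]) *: u k)).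
    rewrite -muE (lin_sum S0lin); apply: eq_bigr => i _.
    by rewrite (linZ S0lin) /= S0sqr bE mul1r S0sym S0sqr bE.
  rewrite (lin_sum S0lin); apply: eq_bigr => k _.
  by rewrite (linZ S0lin) S0sym.
exists p, u, mu; split => //; split => // k kp; apply/andP; split.
  have -> : mu k = '[\sum_(j < p) (mu j * '[u k, u j]) *: u j, u k].
    by rewrite (orthonormal_sum up (fun j => mu j * '[u k, u j]))// up// eqxx mulr1.
  rewrite -muE dot_suml sumr_ge0// => i _.
  by rewrite mul1r dotZl (dotC _ _ (u k)) -expr2 sqr_ge0.
have [h _ hE] := ur k kp.
have h0 : h != 0.
  apply/eqP => h0; have := up k k kp kp; rewrite -hE h0 (lin0 S0lin) dot0l eqxx => /eqP.
  by rewrite eq_sym oner_eq0.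
have := pC h h0; rewrite CE' low_rank_update_dot// hE up// eqxx.
rewrite (bigD1 (Ordinal kp))//= up// eqxx !mulr1 big1 ?addr0 ?subr_gt0// => j jk.
rewrite up// (_ : (k == j :> nat) = false) ?mulr0//.
by apply/negbTE; rewrite eq_sym.
Qed.

Definition precision_update p (h : nat -> H) (nu : nat -> R) : set (H * H) :=
  prior_precision_plus Cpr (fun x => \sum_(k < p) (nu k * '[x, h k]) *: h k).

Lemma update_prec_class r p h nu : (p <= r)%N ->
  (forall k, (k < p)%N -> 0 <= nu k) ->
  prec_class dot Cpr r (precision_update p h nu).
Proof.
move=> pr nu0; have [K [bK KE _]] := gram_exists h pr nu0.
exists K => //; rewrite /precision_update; congr (prior_precision_plus _ _).
by apply/funext => x; rewrite KE.
Qed.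

(** S0 U U^* S0 has finite rank and is diagonalized; its eigenvectors u k lie in the range of S0. U
    U^* is then recovered on the range of [Cpr] only, which is the domain of the graph. *)
Lemma prec_class_update r P : prec_class dot Cpr r P ->
  exists p u h nu, [/\ (p <= r)%N, orthonormal_upto dot p u,
    forall k, (k < p)%N -> S0 (h k) = u k,
    forall k, (k < p)%N -> 0 <= nu k & P = precision_update p h nu].
Proof.
move=> [U [linU bU] ->]; pose b i := U (unit_col r i).
have [p [u [mu [pr up uspan muE]]]] := finite_rank_diag dot r (S0 \o b) (fun=> 1).
have /choice[h hE] : forall k, exists h, (k < p)%N -> S0 h = u k.
  move=> k; have [pk|kp] := leqP p k; first by exists 0.
  have [c uc] := uspan k kp; exists (\sum_(i < r) c i *: b i) => _.
  by rewrite uc (lin_sum S0lin); apply: eq_bigr => i _; rewrite (linZ S0lin).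
exists p, u, h, mu; split => //.
  move=> k kp; have -> : mu k = '[\sum_(j < p) (mu j * '[u k, u j]) *: u j, u k].
    by rewrite (orthonormal_sum up (fun j => mu j * '[u k, u j]))// up// eqxx mulr1.
  rewrite -muE dot_suml sumr_ge0// => i _.
  by rewrite mul1r dotZl (dotC _ _ (u k)) -expr2 sqr_ge0.
have UE x : range Cpr x -> gram dot U x = \sum_(k < p) (mu k * '[x, h k]) *: h k.
  move=> [z _ <-]; rewrite gramE//; apply: S0_eq; rewrite -S0sqr.
  transitivity (\sum_(k < p) (mu k * '[S0 z, u k]) *: u k).
    rewrite -muE (lin_sum S0lin); apply: eq_bigr => i _.
    by rewrite (linZ S0lin) mul1r S0sym.
  rewrite (lin_sum S0lin); apply: eq_bigr => k _.
  by rewrite (linZ S0lin) [in RHS]S0sym hE.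
rewrite /precision_update /prior_precision_plus; apply/seteqP; split => -[x y] /= [xr ->].
  by rewrite UE.
by rewrite UE.
Qed.

(** The Sherman-Morrison-Woodbury identity: since the u k are orthonormal the terms decouple,
    leaving one scalar relation sg = nu / (1 + nu) for each k. *)
Lemma precision_update_inv p u h nu sg : orthonormal_upto dot p u ->
  (forall k, (k < p)%N -> S0 (h k) = u k) ->
  (forall k, (k < p)%N -> nu k * (1 - sg k) = sg k) ->
  graph_inv (precision_update p h nu) = op_graph (update p u sg).
Proof.
move=> up hE nsg.
have [linC _] := bpr.
have Cprh k : (k < p)%N -> Cpr (h k) = S0 (u k) by move=> kp; rewrite -S0sqr hE.
have Cpr0 z : Cpr z = 0 -> z = 0.
  move=> z0; apply: S0_eq; rewrite (lin0 S0lin); apply: S0_eq.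
  by rewrite (lin0 S0lin) S0sqr z0.
have S0u k x : (k < p)%N -> '[x, S0 (u k)] = '[Cpr x, h k].
  by move=> kp; rewrite -S0sym -hE// -S0sym S0sqr.
have hS0u k j : (k < p)%N -> (j < p)%N -> '[h k, S0 (u j)] = (k == j)%:R.
  by move=> kp jp; rewrite -S0sym hE// up.
apply/seteqP; split => -[y x]; rewrite /graph_inv /op_graph /=.
  move=> [[z _ /= zx] /= ->]; rewrite -zx op_inv_eq//= /low_rank_update.
  rewrite (linD linC) (lin_sum linC).
  rewrite -[LHS]addr0 -[RHS]addrA; congr (_ + _).
  rewrite -sumrN -big_split big1// => k _ /=.
  rewrite (linZ linC) Cprh// -scaleNr -scalerDl dotDl dot_suml S0u//.
  rewrite (bigD1 k)//= dotZl hS0u// eqxx mulr1 big1 ?addr0 => [|j jk].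
    rewrite -[RHS](scale0r (S0 (u k))); congr (_ *: _).
    transitivity ('[Cpr z, h k] * (nu k * (1 - sg k) - sg k)); first by ring.
    by rewrite nsg// subrr mulr0.
  by rewrite dotZl hS0u// (_ : (j == k :> nat) = false) ?mulr0//; exact/negbTE.
(* The preimage under [Cpr] of the updated vector, explicit because Cpr (h k) = S0 (u k). *)
move=> ->; pose z := y - \sum_(k < p) (sg k * '[y, S0 (u k)]) *: h k.
have zE : update p u sg y = Cpr z.
  rewrite /low_rank_update /z (linB linC) (lin_sum linC); congr (_ - _).
  by apply: eq_bigr => k _; rewrite (linZ linC) Cprh.
rewrite zE; split; first by exists z.
rewrite op_inv_eq// {1}/z -[LHS](subrK (\sum_(k < p) (sg k * '[y, S0 (u k)]) *: h k)).
congr (_ + _); apply: eq_bigr => k _; congr (_ *: _).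
rewrite -S0u// -[in LHS](nsg k)// -mulrA; congr (_ * _).
rewrite /z dotBl dot_suml (bigD1 k)//= dotZl hS0u// eqxx mulr1 big1 ?addr0.
  by rewrite mulrBl mul1r.
move=> j jk; rewrite dotZl hS0u// (_ : (j == k :> nat) = false) ?mulr0//.
exact/negbTE.
Qed.

End gram_operators.

(** * The posterior covariance and the theorem *)

Lemma sum_below_truncate (V : nmodType) d r m (F : nat -> V) :
  (forall i, (i < m)%N -> below d i) -> (forall i, (m <= i)%N -> F i = 0) ->
  \sum_(i < r | below d i) F i = \sum_(i < minn r m) F i.
Proof.
move=> dm F0; rewrite (big_ord_widen _ F (geq_minl r m)) [LHS]big_mkcond [RHS]big_mkcond.
apply: eq_bigr => i _; rewrite ltn_min ltn_ord /=.
by case: ltnP => [/dm ->//|/F0 ->]; case: ifP.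
Qed.

Section spectral_data.
Context (R : realType) (H : completeNormedModType R) (dot : {dot H for idfun}).
Hypothesis hdot : hilbert dot.
Local Notation "''[' x , y ]" := (dot x y).
Context (n : nat) (G : H -> 'cV[R]_n) (Cobs : 'cV[R]_n -> 'cV[R]_n).
Variable Cpr : H -> H.
Hypotheses (bpr : bounded_operator Cpr) (spr : selfadjoint dot Cpr).
Hypothesis ppr : positive dot Cpr.
Local Notation S0 := (sqrt_op dot Cpr).
Let S0sym := sqrt_sym hdot bpr spr ppr.
Variables (d : option nat) (lam : nat -> R) (w v : nat -> H).
Hypothesis ss : spectral_sequences dot G Cobs Cpr d lam w v.

(** The indices with lam i nonzero are equinumerous with a finite ordinal, so some lam i is 0; m is
    the first, and monotonicity with lam <= 0 does the rest. *)
Lemma spectral_rank : exists m,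
  (forall i, (i < m)%N -> lam i < 0) /\ (forall i, (m <= i)%N -> lam i = 0).
Proof.
have lam_le0 i : lam i <= 0 by have /andP[] := lam_range ss i.
have ex : exists i, lam i == 0.
  apply: contrapT => no; have [k _ fin] := lam_rank ss.
  apply: infinite_nat; exists k; rewrite (_ : [set: nat] = [set i | lam i != 0])//.
  apply/seteqP; split => // i _ /=; apply/eqP => li.
  by apply: no; exists i; apply/eqP.
exists (ex_minn ex); case: ex_minnP => m /eqP lm mmin; split => i im.
  rewrite lt_neqAle lam_le0 andbT; apply/negP => /mmin.
  by rewrite leqNgt im.
by apply/eqP; rewrite eq_le lam_le0 -lm (lam_nondecreasing ss).
Qed.

Local Notation Q := (sqrt_op dot (Cpos dot G Cobs Cpr)).

(* [op_inv] is 0 outside the range, so that v i would vanish. *)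
Lemma posterior_range i : below d i -> S0 (w i) != 0 /\ range Q (S0 (w i)).
Proof.
move=> di; split.
  apply/eqP => /(sqrt_inj hdot bpr spr ppr) w0; have := (w_basis ss).1 i i di di.
  by rewrite w0 dot0l eqxx => /eqP; rewrite eq_sym oner_eq0.
apply: contrapT => no; have := (v_basis ss).1 i i di di.
rewrite (v_def ss di) /op_inv; case: xgetP => [x _ /= xE|_].
  by case: no; exists x.
by rewrite scaler0 dot0l eqxx => /eqP; rewrite eq_sym oner_eq0.
Qed.

Lemma posterior_eigenvectors i : below d i ->
  Q (v i) = Num.sqrt (1 + lam i) *: S0 (w i).
Proof.
move=> di; have [w0 wQ] := posterior_range di.
have [[Qlin _] _ _ _] := sqrt_op_range w0 wQ.
by rewrite (v_def ss di) (linZ Qlin) op_invK.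
Qed.

(** With Q the root of the posterior, <Q x, v i> = sqrt (1 + lam i) <S0 x, w i>. Parseval for Q in
    the basis v, minus Parseval for S0 in the basis w, leaves the sum of the lam i terms. *)
Lemma posterior_update m : (forall i, (i < m)%N -> below d i) ->
  (forall i, (m <= i)%N -> lam i = 0) ->
  Cpos dot G Cobs Cpr = low_rank_update dot Cpr m w (fun i => - lam i).
Proof.
move=> dm lam0; apply/funext => x.
(* With an empty basis there is no w 0 to certify that Q is a genuine root, but then the space is
   trivial. *)
have [d0|d0] := boolP (below d 0); last first.
  have H0 (z : H) : z = 0.
    have := @parseval_sq _ _ _ hdot _ _ (w_basis ss) z.
    rewrite (_ : (fun k => _) = cst 0) => [h|].
      by apply: (@dot_eq0 _ _ dot); apply: (cvg_unique _ h (cvg_cst _)).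
    apply/funext => k; apply: big1 => i _; have := ltn_ord i.
    by rewrite dim_minP => /andP[_ /below_ltn/(_ d0)].
  by rewrite [LHS]H0 [RHS]H0.
have [w0 wQ] := posterior_range d0.
have [_ Qsym _ QQ] := sqrt_op_range w0 wQ.
apply: (@dot_inj _ _ dot) => y; rewrite low_rank_update_dot//.
have -> : '[Cpos dot G Cobs Cpr x, y] = '[Q x, Q y] by rewrite -Qsym -[in LHS](congr1 (@^~ x) QQ).
have Qv z i : below d i -> '[Q z, v i] = Num.sqrt (1 + lam i) * '[S0 z, w i].
  by move=> di; rewrite Qsym posterior_eigenvectors// dotZr S0sym.
have cQ := @parseval _ _ _ hdot _ _ (v_basis ss) (Q x) (Q y).
have cS := @parseval _ _ _ hdot _ _ (w_basis ss) (S0 x) (S0 y).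
suff cD' : (fun k => \sum_(i < dim_min d k) '[Q x, v i] * '[Q y, v i] -
      \sum_(i < dim_min d k) '[S0 x, w i] * '[S0 y, w i]) @ \oo -->
    - \sum_(k < m) - lam k * '[S0 x, w k] * '[S0 y, w k].
  apply: (addIr (- '[S0 x, S0 y])); rewrite addrAC subrr sub0r.
  exact: (cvg_unique _ (cvgB cQ cS) cD').
(* Past m the terms carry lam i = 0, so the difference of the partial sums is eventually
   constant. *)
apply: cvg_near_cst; near=> k.
have mk : (m <= dim_min d k)%N.
  by apply: dim_min_id => //; near: k; exact: nbhs_infty_ge.
transitivity (\sum_(i < dim_min d k) lam i * '[S0 x, w i] * '[S0 y, w i]); last first.
  rewrite (big_ord_split_at (fun i => lam i * '[S0 x, w i] * '[S0 y, w i]) mk).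
  rewrite [X in _ + X]big1 ?addr0 => [|i _]; last first.
    by rewrite lam0 ?leq_addr// !mul0r.
  by rewrite -sumrN; apply: eq_bigr => i _; rewrite !mulNr opprK.
rewrite -sumrB; apply: eq_bigr => i _.
have := ltn_ord i; rewrite dim_minP => /andP[_ di] /=; rewrite !Qv//.
have /andP[l1 _] := lam_range ss i.
have : Num.sqrt (1 + lam i) ^+ 2 = 1 + lam i by rewrite sqr_sqrtr//; lra.
move: (Num.sqrt _) '[S0 x, w i] '[S0 y, w i] => s a b h.
by transitivity (s ^+ 2 * (a * b) - a * b); [|rewrite h]; ring.
Unshelve. all: by end_near. Qed.

End spectral_data.

Lemma graph_funK (R : realType) (V : lmodType R) (C : V -> V) :
  graph_fun (op_graph C) = C.
Proof.
by apply/funext => x; rewrite /graph_fun; case: xgetP => [//|/(_ (C x))[]].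
Qed.

Lemma cvg_truncated_series (R : realType) r m (lam : nat -> R) (f : R -> R) :
  (forall i, (m <= i)%N -> lam i = 0) -> f 0 = 0 ->
  series (fun i => f (lam (r + i)%N)) @ \oo -->
    \sum_(i < m - minn r m) f (lam (minn r m + i)%N).
Proof.
move=> lam0 f0; apply: (@cvg_near_cst _ _ _ _ _ _).
near=> k; have mk : (m <= k)%N by near: k; exact: nbhs_infty_ge.
rewrite /series /= big_mkord; have [mr|rm] := leqP m r.
  rewrite subnn big_ord0 big1// => i _.
  by rewrite lam0 ?f0// (leq_trans mr) ?leq_addr.
rewrite (big_ord_split_at (fun i => f (lam (r + i)%N)) (leq_trans (leq_subr r m) mk)).
rewrite [X in _ + X]big1 ?addr0// => i _.
by rewrite lam0 ?f0// addnA subnKC ?leq_addr// ltnW.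
Unshelve. all: by end_near. Qed.

(* The other minimizer is obtained by exchanging w (r - 1) and w r. *)
Lemma truncation_not_unique (R : realType) (H : completeNormedModType R)
    (dot : {dot H for idfun}) (Cpr : H -> H)
    (d : option nat) (b : nat -> H) (m : nat) (lam : nat -> R) (w : nat -> H)
    (r : nat) :
  hilbert dot -> bounded_operator Cpr -> selfadjoint dot Cpr ->
  positive dot Cpr -> orthonormal_basis dot d b -> orthonormal_upto dot m w ->
  (forall i, (i < m)%N -> range (sqrt_op dot Cpr) (w i)) ->
  (forall i, -1 < lam i) -> (forall i, (i < m)%N -> lam i < 0) ->
  (forall i, (m <= i)%N -> lam i = 0) ->
  (0 < r)%N -> (r < m)%N -> lam r.-1 = lam r ->
  let C := low_rank_update dot Cpr r w (fun i => - lam i) in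
  let Cp := low_rank_update dot Cpr m w (fun i => - lam i) in
  exists u, [/\ update_data dot Cpr r u (fun i => - lam i),
    low_rank_update dot Cpr r u (fun i => - lam i) <> C &
    forall f, loss_class f ->
      loss dot f Cp (low_rank_update dot Cpr r u (fun i => - lam i)) =
      loss dot f Cp C].
Proof.
move=> hdot bpr spr ppr bb wo wr lam_gt lam_lt0 lam_eq0 r0 rm lamr C Cp.
have rm1 : (r.-1 < m)%N by apply: leq_ltn_trans rm; exact: leq_pred.
pose s (i : nat) := if i == r.-1 then r else if i == r then r.-1 else i.
have r1r : (r.-1 == r) = false by rewrite ltn_eqF// prednK.
have sK : involutive s.
  move=> i; rewrite /s; have [->|i1] := eqVneq i r.-1; first by rewrite eqxx eq_sym r1r.
  have [->|i2] := eqVneq i r; first by rewrite eqxx.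
  by rewrite (negbTE i1) (negbTE i2).
have sm i : (i < m)%N -> (s i < m)%N by rewrite /s; do 2?case: ifP.
have lams i : lam (s i) = lam i.
  by rewrite /s; have [->//|_] := eqVneq i r.-1; have [->|] := eqVneq i r.
pose u (i : nat) := w (s i).
have uo : orthonormal_upto dot m u.
  by move=> i j im jm; rewrite /u wo ?sm// (inj_eq (can_inj sK)).
have ur i : (i < m)%N -> range (sqrt_op dot Cpr) (u i) by move=> /sm/wr.
(* The exchanged vectors carry equal lam, so the swapped family describes the same posterior and
   [loss_truncation] applies to it too. *)
have CpE : Cp = low_rank_update dot Cpr m u (fun i => - lam i).
  apply/funext => x; congr (_ - _).
  pose S (i : 'I_m) : 'I_m := Ordinal (sm i (ltn_ord i)).
  have SK : involutive S by move=> i; apply: val_inj; exact: sK.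
  rewrite (reindex_inj (can_inj SK)); apply: eq_bigr => i _ /=.
  by rewrite lams.
exists u; split.
- exact: (spectral_update_data uo ur lam_gt lam_lt0 lam_eq0 (ltnW rm)).
(* At g with S0 g = w (r - 1), the form of C is 1 + lam (r - 1) < 1, while that of the swapped
   truncation is 1. *)
- move=> CC; have [g _ gE] := wr _ rm1.
  have := congr1 (fun A => dot (A g) g) CC.
  rewrite /C !low_rank_update_dot// gE => /addrI/oppr_inj.
  rewrite big1 => [|k _]; last first.
    rewrite /u wo ?sm ?(ltn_trans (ltn_ord k))// eq_sym.
    rewrite (_ : (s k == r.-1) = false) ?mulr0//.
    by rewrite -(inj_eq (can_inj sK)) sK /s eqxx ltn_eqF.
  have k1 : (r.-1 < r)%N by rewrite prednK.
  rewrite (bigD1 (Ordinal k1))//= wo// eqxx !mulr1 big1 ?addr0 => [|k kr].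
    by move=> /eqP; rewrite eq_sym oppr_eq0 lt_eqF// lam_lt0.
  rewrite [X in _ * X * _]wo ?(ltn_trans (ltn_ord k))//.
  rewrite (_ : (r.-1 == k :> nat) = false) ?mulr0 ?mul0r//.
  by apply/negbTE; rewrite eq_sym.
- move=> f lf; rewrite {1}CpE.
  rewrite (loss_truncation hdot bpr spr ppr bb uo ur lam_gt lam_lt0 lam_eq0 (ltnW rm) lf).
  by rewrite (loss_truncation hdot bpr spr ppr bb wo wr lam_gt lam_lt0 lam_eq0 (ltnW rm) lf).
Qed.

Theorem theorem4p21 (R : realType) (H : completeNormedModType R)
    (dot : {dot H for idfun}) (n r : nat)
    (G : H -> 'cV[R]_n) (Cobs : 'cV[R]_n -> 'cV[R]_n) (Cpr : H -> H)
    (d : option nat) (lam : nat -> R) (w v : nat -> H) :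
  hilbert dot -> separable H ->
  bounded_operator G ->
  bounded_operator Cobs -> selfadjoint (euclidean R n) Cobs ->
  positive (euclidean R n) Cobs ->
  trace_class dot Cpr -> selfadjoint dot Cpr -> positive dot Cpr ->
  spectral_sequences dot G Cobs Cpr d lam w v ->
  (r <= n)%N ->
  let Cpos := Cpos dot G Cobs Cpr in
  let Popt := Popt dot Cpr d lam w r in
  let Copt := Copt dot Cpr d lam w r in
  [/\ (* (1) *)
      optimal_prec dot G Cobs Cpr r Popt,
      (* (2) *)
      optimal_cov dot G Cobs Cpr r Copt,
      (* (3) *)
      graph_inv Popt = op_graph Copt /\ graph_inv (op_graph Copt) = Popt,
      (* (4) *)
      forall f, loss_class f ->
        series (fun i => f (lam (r + i)%N)) @ \oo --> loss dot f Cpos Copt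
    & (* (5), the case r = 0, where there is no lambda_r, being excluded *)
      (0 < r)%N ->
      ((forall P, optimal_prec dot G Cobs Cpr r P -> P = Popt) /\
       (forall C, optimal_cov dot G Cobs Cpr r C -> C = Copt)
       <-> lam r = 0 \/ lam r.-1 < lam r)].
Proof.
move=> hdot _ _ _ _ _ [bpr _] spr ppr ss _ Cpo Po Co.
have [m [lam_lt0 lam_eq0]] := spectral_rank ss.
have lam_gt i : -1 < lam i by have /andP[] := lam_range ss i.
have lam_mono := lam_nondecreasing ss.
have wd i : (i < m)%N -> below d i.
  move=> im; apply: contraT => /(lam_beyond ss) li.
  by have := lam_lt0 i im; rewrite li ltxx.
have wb := w_basis ss.
have wo : orthonormal_upto dot m w by move=> i j im jm; apply: wb.1; exact: wd.
have wr i : (i < m)%N -> range (sqrt_op dot Cpr) (w i).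
  by move=> im; apply: (w_range ss); exact: wd.
pose C0 := low_rank_update dot Cpr (minn r m) w (fun i => - lam i).
pose h i := op_inv (sqrt_op dot Cpr) (w i).
pose nu i := - lam i / (1 + lam i).
have hE k : (k < minn r m)%N -> sqrt_op dot Cpr (h k) = w k.
  rewrite leq_min => /andP[_ km]; apply: op_invK; exact: wr.
have CpoE : Cpo = low_rank_update dot Cpr m w (fun i => - lam i).
  exact: (posterior_update hdot bpr spr ppr ss wd lam_eq0).
have CoE : Co = C0.
  apply/funext => x; congr (_ - _).
  rewrite (sum_below_truncate r (m := m) (F := fun i => - lam i *:
    tensor dot (sqrt_op dot Cpr (w i)) (sqrt_op dot Cpr (w i)) x))//.
    by apply: eq_bigr => i _; rewrite /tensor scalerA dotC.
  by move=> i im; rewrite lam_eq0// oppr0 scale0r.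
have PoE : Po = precision_update dot Cpr (minn r m) h nu.
  rewrite /Po /Popt /precision_update; congr (prior_precision_plus _ _).
  apply/funext => x.
  rewrite (sum_below_truncate r (m := m) (F := fun i => (- lam i / (1 + lam i)) *:
    tensor dot (h i) (h i) x))//.
    by apply: eq_bigr => i _; rewrite /tensor scalerA dotC.
  by move=> i im; rewrite lam_eq0// oppr0 mul0r scale0r.
have nr : (minn r m <= r)%N by exact: geq_minl.
have nm : (minn r m <= m)%N by exact: geq_minr.
have ud := spectral_update_data wo wr lam_gt lam_lt0 lam_eq0 nm.
have wno : orthonormal_upto dot (minn r m) w by case: ud.
have inv0 : graph_inv Po = op_graph C0.
  rewrite PoE; apply: (precision_update_inv hdot bpr spr ppr wno hE) => k _.
  by rewrite /nu opprK divfK// gt_eqF//; have := lam_gt k; lra.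
have nu_ge0 k : 0 <= nu k.
  have /andP[l1 l0] := lam_range ss k.
  by apply: divr_ge0; lra.
have prec_inv P : prec_class dot Cpr r P -> exists p u sg, [/\ (p <= r)%N,
    update_data dot Cpr p u sg & graph_inv P = op_graph (low_rank_update dot Cpr p u sg)].
  move=> /(prec_class_update hdot bpr spr ppr)[p [u [k [t [pr uo kE t0 ->]]]]].
  (* The solution sg of t (1 - sg) = sg, which lies in [0, 1[ for t >= 0. *)
  exists p, u, (fun i => t i / (1 + t i)); split => //.
    split => // i ip; first by exists (k i) => //; exact: kE.
    have ti := t0 i ip; rewrite divr_ge0//=; last lra.
    by rewrite ltr_pdivrMr; lra.
  apply: (precision_update_inv hdot bpr spr ppr uo kE) => i ip.
  have ti := t0 i ip; field; apply/eqP; lra.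
have le0 p u sg f : (p <= r)%N -> update_data dot Cpr p u sg -> loss_class f ->
    loss dot f Cpo C0 <= loss dot f Cpo (low_rank_update dot Cpr p u sg).
  move=> pr ud' lf; rewrite CpoE.
  exact: (truncation_le hdot bpr spr ppr wb wo wr lam_gt lam_lt0 lam_eq0 lam_mono pr ud' lf).
have lossE f : loss_class f ->
    loss dot f Cpo C0 = \sum_(i < m - minn r m) f (lam (minn r m + i)%N).
  move=> lf; rewrite CpoE.
  exact: (loss_truncation hdot bpr spr ppr wb wo wr lam_gt lam_lt0 lam_eq0 nm lf).
have optC : optimal_cov dot G Cobs Cpr r C0.
  split; first exact: update_cov_class.
  move=> f lf C /(cov_class_update hdot bpr spr ppr)[p [u [sg [pr ud' ->]]]].
  exact: le0.
have optP : optimal_prec dot G Cobs Cpr r Po.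
  split; first by rewrite PoE; exact: update_prec_class.
  move=> f lf P' /prec_inv[p [u [sg [pr ud' ->]]]].
  by rewrite inv0 !graph_funK; exact: le0.
have graph_invK P : graph_inv (graph_inv P) = P :> set (H * H).
  by apply/seteqP; split => -[].
have uniq p u sg : lam r = 0 \/ lam r.-1 < lam r -> (p <= r)%N ->
    update_data dot Cpr p u sg ->
    loss dot (fun t : R => t ^+ 2) Cpo (low_rank_update dot Cpr p u sg) <=
    loss dot (fun t : R => t ^+ 2) Cpo C0 -> low_rank_update dot Cpr p u sg = C0.
  move=> gap pr ud' le; apply/funext => x.
  apply: (sqr_loss_unique hdot bpr spr ppr wb wo wr lam_gt lam_lt0 lam_eq0 lam_mono pr ud').
    (* Indices start at 0, so lam r is lambda_(r+1): its vanishing contradicts r < m, and otherwise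
       monotonicity extends the gap from r - 1 to all i < r. *)
    move=> i rm ir; case: gap => [l0|lt]; first by have := lam_lt0 r rm; rewrite l0 ltxx.
    by apply: le_lt_trans lt; apply: lam_mono; case: (r) ir.
  rewrite -CpoE; apply: le_trans le _; rewrite lossE; last exact: loss_class_sqr.
  have [mr|//] := leqP m r.
  by rewrite subnn big_ord0 sumr_ge0// => i _; exact: sqr_ge0.
rewrite CoE; split => //.
- by split => //; rewrite -inv0.
- move=> f lf; rewrite lossE//.
  exact: (@cvg_truncated_series _ r m lam f lam_eq0 (loss_at0 lf)).
- move=> r0; split => [[_ uniqC]|gap].
    apply: contrapT => no.
    have rm : (r < m)%N.
      by rewrite ltnNge; apply/negP => mr; apply: no; left; exact: lam_eq0.
    have lamr : lam r.-1 = lam r.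
      apply/eqP; rewrite eq_le lam_mono ?leq_pred//= leNgt; apply/negP => lt.
      by apply: no; right.
    have [u [ud' uC uL]] := truncation_not_unique hdot bpr spr ppr wb wo wr
      lam_gt lam_lt0 lam_eq0 r0 rm lamr.
    have C0E : C0 = low_rank_update dot Cpr r w (fun i => - lam i).
      by rewrite /C0 (minn_idPl (ltnW rm)).
    apply: uC; rewrite -C0E; apply: uniqC; split; first exact: update_cov_class.
    (* Having the losses of C0 for every f, the swapped truncation is a second simultaneous
       minimizer. *)
    move=> f lf C' cC'; rewrite -/Cpo CpoE uL// -C0E -CpoE.
    exact: optC.2.
  split=> [P [Pr Popt]|C [Cr Copt]].
    have [p [u [sg [pr ud' PE]]]] := prec_inv P Pr.
    rewrite -[LHS]graph_invK PE -[RHS]graph_invK inv0; congr (graph_inv (op_graph _)).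
    apply: uniq => //.
    have := Popt _ (@loss_class_sqr R) Po optP.1.
    by rewrite PE inv0 !graph_funK.
  have [p [u [sg [pr ud' CE]]]] := cov_class_update hdot bpr spr ppr Cr.
  rewrite CE; apply: uniq => //; rewrite -CE.
  exact: Copt _ (@loss_class_sqr R) C0 optC.1.
Qed.
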